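(* Let $c_1,\ldots,c_5\in\mathbb{R}$ with $c_4\neq0$, and let $U_*$, $E$ and $G$ be as defined in the context. For sufficiently small $t>0$, let $U_0=G(t)$ and define the sequence $U_{k+1}=P_E\circ P_{\mathbb{S}^3_+}(U_k)$, $k=0,1,2,\ldots$. Then $\|U_k-U_*\|=\Theta(k^{-1/6})$ as $k\to\infty$. Moreover, $$\lim_{k\to\infty}\left(\frac{3}{32c_4^4(2c_1^2+1)^4}\right)^{1/6}k^{1/6}\|U_k-U_*\|=1.$$
   Context: $\mathbb{S}^3$ is the space of real symmetric $3\times3$ matrices with inner product $\langle A,B\rangle=\operatorname{tr}(A^TB)$ and Frobenius norm $\|\cdot\|$; $\mathbb{S}^3_+$ is the cone of positive semidefinite matrices; $P_C$ denotes the nearest-point projection onto a closed convex set $C$. $a_k=\Theta(b_k)$ means $C_1b_k\le a_k\le C_2b_k$ for some constants $C_1,C_2>0$ and all large $k$. Let $c_1,\ldots,c_5\in\mathbb{R}$, $c_4\ne0$, $U_*=\begin{pmatrix}1&0&0\\0&0&0\\0&0&0\end{pmatrix}$ and $$B_1=\begin{pmatrix}-2c_1&1&0\\1&0&0\\0&0&0\end{pmatrix},\quad B_2=\begin{pmatrix}2c_2&0&-1\\0&2c_4&0\\-1&0&0\end{pmatrix},\quad B_3=\begin{pmatrix}-2c_3&0&0\\0&-2c_5&1\\0&1&0\end{pmatrix},$$ $$E=\{U_*+p_1B_1+p_2B_2+p_3B_3:p\in\mathbb{R}^3\}.$$ Define the following rational functions of $t$ (near $t=0$): $$w=1-2c_1t+\frac{c_2t^2}{c_4\Big(1-2c_1t+\frac{c_2t^2}{c_4(1-2c_1t)+c_5t}+\frac{c_3t^3}{c_4}\Big)+c_5t}+\frac{c_3t^3}{\Big(c_4\big(1-2c_1t+\frac{c_2t^2}{c_4}\big)+c_5t\Big)\big(1-2c_1t+\frac{c_2t^2}{c_4}\big)},$$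 $$\tilde g_{13}=\frac{t^2}{2c_4w+2c_5t}-\frac{2(2c_5^2+1)t^6}{(2c_4w+2c_5t)^5},\qquad r_0=\frac{c_4\langle B_3,B_1\rangle+c_5\langle B_2,B_1\rangle}{8c_4^5\|B_1\|^2}+\frac1{8c_4^3},$$ $$r_{13}=\frac{c_5}{c_4}r_0t^7+\frac{\langle B_2,B_1\rangle}{16c_4^6\|B_1\|^2}t^7,\qquad r_{23}=-\frac{2c_5t^6}{(2c_4w+2c_5t)^4w}+r_0t^7,$$ $$g_{13}=\tilde g_{13}+r_{13},\qquad g_{23}=-\frac{\tilde g_{13}}{w}t+r_{23},$$ $$G(t)=U_*+tB_1+g_{13}B_2+g_{23}B_3.$$ *)

(* Defs.v *)
From mathcomp Require Import all_boot all_order all_algebra.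
From mathcomp Require Import all_classical all_reals all_analysis.
Set Implicit Arguments.
Unset Strict Implicit.
Unset Printing Implicit Defensive.
Import Order.TTheory GRing.Theory Num.Theory.
Import numFieldNormedType.Exports.
Local Open Scope classical_set_scope.
Local Open Scope ring_scope.

Section Frobenius.
Variables (R : realType) (n : nat).
Implicit Types (A B X Y : 'M[R]_n) (C : set 'M[R]_n).

Definition frob_dot A B : R := \tr (A^T *m B).

(* The canonical norm `|A| on matrices is the max norm, not this one. *)
Definition frob_norm A : R := Num.sqrt (frob_dot A A).

Definition psd_cone : set 'M[R]_n :=
  [set A | A^T = A /\ forall x : 'cV[R]_n, 0 <= (x^T *m A *m x) 0 0].

Definition is_nearest C X Y : Prop :=
  C Y /\ forall Z, C Z -> frob_norm (X - Y) <= frob_norm (X - Z).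

(* The default value X is only returned when X has no nearest point in C, which
   does not happen when C is nonempty, closed and convex. *)
Definition proj C X : 'M[R]_n := xget X [set Y | is_nearest C X Y].

End Frobenius.

Definition Theta (R : realType) (a b : nat -> R) : Prop :=
  exists C1 C2 : R, [/\ 0 < C1, 0 < C2 &
    \forall k \near \oo, C1 * b k <= a k <= C2 * b k].

Definition mx3 (R : realType) (rows : seq (seq R)) : 'M[R]_3 :=
  \matrix_(i < 3, j < 3) (nth [::] rows i)`_j.

Section Spectrahedron.
Variables (R : realType) (c1 c2 c3 c4 c5 : R).

Definition Ustar : 'M[R]_3 :=
  mx3 [:: [:: 1; 0; 0];
          [:: 0; 0; 0];
          [:: 0; 0; 0]].

Definition B1 : 'M[R]_3 :=
  mx3 [:: [:: - 2 * c1; 1; 0];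
          [:: 1;        0; 0];
          [:: 0;        0; 0]].

Definition B2 : 'M[R]_3 :=
  mx3 [:: [:: 2 * c2; 0;      -1];
          [:: 0;      2 * c4; 0];
          [:: -1;     0;      0]].

Definition B3 : 'M[R]_3 :=
  mx3 [:: [:: - 2 * c3; 0;        0];
          [:: 0;        - 2 * c5; 1];
          [:: 0;        1;        0]].

Definition affineE : set 'M[R]_3 :=
  [set X | exists p1 p2 p3 : R,
     X = Ustar + p1 *: B1 + p2 *: B2 + p3 *: B3].

(* For c4 != 0 all the denominators below are nonzero for t near 0, t > 0. *)
Definition w (t : R) : R :=
  1 - 2 * c1 * t
  + c2 * t ^+ 2 /
    (c4 * (1 - 2 * c1 * t
           + c2 * t ^+ 2 / (c4 * (1 - 2 * c1 * t) + c5 * t)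
           + c3 * t ^+ 3 / c4)
     + c5 * t)
  + c3 * t ^+ 3 /
    ((c4 * (1 - 2 * c1 * t + c2 * t ^+ 2 / c4) + c5 * t)
     * (1 - 2 * c1 * t + c2 * t ^+ 2 / c4)).

Definition gt13 (t : R) : R :=
  t ^+ 2 / (2 * c4 * w t + 2 * c5 * t)
  - 2 * (2 * c5 ^+ 2 + 1) * t ^+ 6 / (2 * c4 * w t + 2 * c5 * t) ^+ 5.

Definition r0 : R :=
  (c4 * frob_dot B3 B1 + c5 * frob_dot B2 B1)
    / (8 * c4 ^+ 5 * frob_norm B1 ^+ 2)
  + 1 / (8 * c4 ^+ 3).

Definition r13 (t : R) : R :=
  c5 / c4 * r0 * t ^+ 7
  + frob_dot B2 B1 / (16 * c4 ^+ 6 * frob_norm B1 ^+ 2) * t ^+ 7.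

Definition r23 (t : R) : R :=
  - (2 * c5 * t ^+ 6 / ((2 * c4 * w t + 2 * c5 * t) ^+ 4 * w t))
  + r0 * t ^+ 7.

Definition g13 (t : R) : R := gt13 t + r13 t.

Definition g23 (t : R) : R := - (gt13 t / w t) * t + r23 t.

Definition G (t : R) : 'M[R]_3 :=
  Ustar + t *: B1 + g13 t *: B2 + g23 t *: B3.

Definition U (t : R) (k : nat) : 'M[R]_3 :=
  iter k (fun X => proj affineE (proj (@psd_cone R 3) X)) (G t).

End Spectrahedron.

(* Main.v *)
(** Write X = U_* + p1 B1 + p2 B2 + p3 B3.  Near U_* the matrix X has exactly one
    eigenvalue close to 1, with an eigenvector z = (1, x, y), and X = h z z^T - N
    with N z = 0; so N is determined by its lower 2x2 block [[a, b], [b, h y^2]].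
    As long as this block is positive semidefinite, the projection onto the cone
    is h z z^T, and the next iterate is X plus the projection of N onto the
    direction space of E.

    Let q be the B1-component of X and f the part orthogonal to B1 of the step.
    The linearization of the iteration at U_* fixes B1 and contracts f strictly, so
    |f| <= K q^7 is preserved for small q.  In this tube a bootstrap in powers of q
    gives y ~ - q^2 / (2 c4) and a ~ q^6 / (8 c4^4) > 0 (hence positivity of the
    block), and q' = q - q^7 / (8 c4^4 (1 + 2 c1^2)) + O(q^8).  The curve G is tuned
    to start inside such a tube.  Finally q^-6 grows by asymptotically constant
    increments, and the Cesaro mean yields the limit of k q^6. *)

(* The eigenpair (h, x, y) is known only implicitly, so a step has no closed expansion. What
   replaces it: a transverse step of order 7 means that the component of N in the direction space
   orthogonal to [B1] has order 7, and the two resulting equations determine a and b to leading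
   order. This order is also that of the drift of q, so the transverse motion cannot be dropped as a
   higher order term. Taking for q the coefficient of the orthogonal projection onto [B1], and not
   p1, removes the transverse part of the step from q' - q exactly. The contraction rests on c4 !=
   0: to leading order N changes by minus the lower block of the step, and every direction
   orthogonal to [B1] carries a fixed proportion of its norm in that block. All estimates are taken
   along filters on sets of states, so that their thresholds are uniform and serve every k at
   once. *)
Require Import Defs.
From mathcomp Require Import all_boot all_order all_algebra.
From mathcomp Require Import all_classical all_reals all_analysis.
From mathcomp Require Import ring lra zify.
Import Order.TTheory GRing.Theory Num.Theory.
Import numFieldNormedType.Exports.
Local Open Scope classical_set_scope.
Local Open Scope ring_scope.

(** * Projections onto a closed convex set *)

Section Projection.
Context {R : realType} {n : nat}.
Implicit Types (A B X Y Z : 'M[R]_n).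

Lemma frob_dotE A B : frob_dot A B = \sum_i \sum_j A i j * B i j.
Proof.
rewrite /frob_dot /mxtrace exchange_big; apply: eq_bigr => j _.
by rewrite mxE; apply: eq_bigr => i _; rewrite mxE.
Qed.

Lemma frob_dot_ge0 A : 0 <= frob_dot A A.
Proof.
rewrite frob_dotE; apply: sumr_ge0 => i _; apply: sumr_ge0 => j _.
by rewrite -expr2 sqr_ge0.
Qed.

Lemma frob_dot_eq0 A : frob_dot A A = 0 -> A = 0.
Proof.
rewrite frob_dotE => /eqP; rewrite psumr_eq0 => [/allP h|i _]; last first.
  by apply: sumr_ge0 => j _; rewrite -expr2 sqr_ge0.
apply/matrixP => i j; rewrite mxE.
have := h i (mem_index_enum i).
rewrite psumr_eq0 => [/allP /(_ j (mem_index_enum j)) /=|k _].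
  by rewrite mulf_eq0 orbb => /eqP.
by rewrite -expr2 sqr_ge0.
Qed.

Lemma frob_dotDZ A B (u v : R) C :
  frob_dot (u *: A + v *: B) C = u * frob_dot A C + v * frob_dot B C.
Proof.
by rewrite /frob_dot linearD !linearZ /= mulmxDl linearD /= -!scalemxAl !linearZ.
Qed.

Lemma frob_dotC A B : frob_dot A B = frob_dot B A.
Proof. by rewrite /frob_dot -[LHS]mxtrace_tr trmx_mul trmxK. Qed.

Lemma frob_dotBB X Y Z :
  frob_dot (X - Z) (X - Z) =
  frob_dot (X - Y) (X - Y) + 2 * frob_dot (X - Y) (Y - Z) + frob_dot (Y - Z) (Y - Z).
Proof.
have -> : X - Z = 1 *: (X - Y) + 1 *: (Y - Z) by rewrite !scale1r addrA subrK.
rewrite frob_dotDZ ![frob_dot _ (1 *: _ + _)]frob_dotC !frob_dotDZ.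
by rewrite (frob_dotC (Y - Z) (X - Y)); ring.
Qed.

(** The variational inequality and the expansion of |X - Z|^2 around Y give |X - Z|^2 >= |X - Y|^2 +
    |Y - Z|^2, so Y is the only nearest point and [xget] has no other choice. *)
Lemma proj_eq (C : set 'M[R]_n) X Y :
  C Y -> (forall Z, C Z -> 0 <= frob_dot (X - Y) (Y - Z)) -> Defs.proj C X = Y.
Proof.
move=> CY hY; have near : is_nearest C X Y.
  split=> // Z CZ; rewrite ler_sqrt ?frob_dot_ge0// (frob_dotBB X Y Z).
  have := hY _ CZ; have := frob_dot_ge0 (Y - Z); lra.
rewrite /Defs.proj; case: xgetP => [Z _ [CZ hZ]|/(_ Y)//].
have := hZ _ CY; rewrite ler_sqrt ?frob_dot_ge0// (frob_dotBB X Y Z) => le.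
apply/esym/eqP; rewrite -subr_eq0; apply/eqP/frob_dot_eq0.
have := hY _ CZ; have := frob_dot_ge0 (Y - Z); lra.
Qed.

Lemma frob_dot_rank1 (v : 'cV[R]_n) Z :
  frob_dot (v *m v^T) Z = (v^T *m Z *m v) 0 0.
Proof.
rewrite /frob_dot trmx_mul trmxK -(mulmxA v) mxtrace_mulC /mxtrace big_ord1.
by [].
Qed.

(** Moreau's criterion: Y and Y - X lie in the cone and are orthogonal. Membership of Y - X is given
    by rank one terms because pairing such a term with Z is a value of the quadratic form of Z. *)
Lemma proj_psd_eq X Y (s : seq (R * 'cV[R]_n)) :
  psd_cone Y ->
  Y - X = \sum_(uv <- s) uv.1 *: (uv.2 *m uv.2^T) ->
  (forall uv, uv \in s -> 0 <= uv.1) ->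
  frob_dot (Y - X) Y = 0 ->
  Defs.proj (@psd_cone R n) X = Y.
Proof.
move=> pY eN hs h0; apply: proj_eq => // Z [_ pZ].
have -> : X - Y = (-1) *: (Y - X) + 0 *: 0 by rewrite scaler0 addr0 scaleN1r opprB.
rewrite frob_dotDZ mul0r addr0 frob_dotC.
have -> : Y - Z = 1 *: Y + (-1) *: Z by rewrite scale1r scaleN1r.
rewrite frob_dotDZ frob_dotC h0 mulr0 add0r !mulN1r opprK frob_dotC eN.
rewrite /frob_dot linear_sum mulmx_suml linear_sum big_seq /=; apply: sumr_ge0 => -[u v] /hs /= u0.
rewrite linearZ /= -scalemxAl mxtraceZ mulr_ge0//.
by have := pZ v; rewrite -frob_dot_rank1.
Qed.
End Projection.

(** * Asymptotic bounds along a filter *)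

(** A parameter tending to 0 from the right. One calculus thus serves states in the tube, pairs of
    consecutive states, [t] near [0^'+], and the sequence q as k tends to infinity. *)
Class Scale {R : realType} {T : Type} (F : set_system T) (tau : T -> R) := {
  scale_filter :: Filter F;
  scaleP : forall e, 0 < e -> \forall s \near F, 0 < tau s < e }.

(** [f = O(tau^k)] along [F]. *)
Definition bO {R : realType} {T : Type} (F : set_system T) (tau : T -> R)
  (k : nat) (f : T -> R) : Prop :=
  exists C : R, \forall s \near F, `|f s| <= C * tau s ^+ k.

Section BigO.
Context {R : realType} {T : Type} {F : set_system T} {tau : T -> R}.
Context {S : Scale F tau}.
Implicit Types f g : T -> R.
Local Notation O := (bO F tau).

Lemma bO_pos {k f} : O k f ->
  exists2 C : R, 0 < C & \forall s \near F, `|f s| <= C * tau s ^+ k.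
Proof.
move=> [C hC]; exists (`|C| + 1); first by rewrite ltr_wpDl.
apply: filterS2 hC (scaleP 1 ltr01) => s /le_trans + /andP[t0 _]; apply.
by rewrite ler_wpM2r ?exprn_ge0 ?(ltW t0)// (le_trans (ler_norm C))// lerDl.
Qed.

Lemma bO_cst c : O 0 (fun=> c).
Proof. by exists `|c|; apply: nearW => s; rewrite expr0 mulr1. Qed.

Lemma bO_scale : O 1 tau.
Proof.
exists 1; apply: filterS (scaleP 1 ltr01) => s /andP[t0 _].
by rewrite expr1 mul1r gtr0_norm.
Qed.

Lemma bO_le {i j f} : (i <= j)%N -> O j f -> O i f.
Proof.
move=> ij /bO_pos[C C0 hC]; exists C.
apply: filterS2 hC (scaleP 1 ltr01) => s /le_trans + /andP[t0 t1]; apply.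
rewrite ler_pM2l//; apply: ler_wiXn2l => //; exact: ltW.
Qed.

Lemma bO_eq {k f} g : (\forall s \near F, f s = g s) -> O k g -> O k f.
Proof.
by move=> fg [C hC]; exists C; apply: filterS2 fg hC => s ->.
Qed.

Lemma bO_add {i j f g} : O i f -> O j g -> O (minn i j) (fun s => f s + g s).
Proof.
move=> /(bO_le (geq_minl i j))[C hC] /(bO_le (geq_minr i j))[D hD].
exists (C + D); apply: filterS2 hC hD => s fs gs.
by rewrite mulrDl (le_trans (ler_normD _ _))// lerD.
Qed.

Lemma bO_opp {i f} : O i f -> O i (fun s => - f s).
Proof. by move=> [C hC]; exists C; apply: filterS hC => s; rewrite normrN. Qed.

Lemma bO_mul {i j f g} : O i f -> O j g -> O (i + j) (fun s => f s * g s).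
Proof.
move=> [C hC] [D hD]; exists (C * D); apply: filterS2 hC hD => s fs gs.
by rewrite exprD mulrACA normrM ler_pM.
Qed.

Lemma bO_exp {i f} n : O i f -> O (n * i) (fun s => f s ^+ n).
Proof.
move=> [C hC]; exists (C ^+ n); apply: filterS hC => s fs.
by rewrite mulnC exprM -exprMn normrX lerXn2r// nnegrE// (le_trans _ fs).
Qed.

Lemma bO_inv {c f} : 0 < c -> (\forall s \near F, c <= `|f s|) ->
  O 0 (fun s => (f s)^-1).
Proof.
move=> c0 hf; exists c^-1; apply: filterS hf => s fs.
by rewrite expr0 mulr1 normfV lef_pV2// posrE (lt_le_trans c0).
Qed.

(** A spare power of [tau] absorbs the unknown constant; this is how orders become explicit
    inequalities. *)
Lemma bO_small {k f e} : 0 < e -> O k.+1 f ->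
  \forall s \near F, `|f s| <= e * tau s ^+ k.
Proof.
move=> e0 /bO_pos[C C0 hC].
apply: filterS2 hC (scaleP (e / C) (divr_gt0 e0 C0)) => s /le_trans + /andP[t0 t1]; apply.
rewrite exprS mulrA ler_wpM2r ?exprn_ge0 ?(ltW t0)//.
by rewrite mulrC -ler_pdivlMr// ltW.
Qed.

Lemma bO_small0 {f e} : 0 < e -> O 1 f -> \forall s \near F, `|f s| <= e.
Proof. by move=> e0 /(bO_small e0); apply: filterS => s; rewrite expr0 mulr1. Qed.

Lemma bO_inv1 {f c} : c != 0 -> O 1 (fun s => f s - c) ->
  (\forall s \near F, f s != 0) /\ O 0 (fun s => (f s)^-1).
Proof.
move=> c0 hf; have c2 : 0 < `|c| / 2 by rewrite divr_gt0// normr_gt0.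
have ge : \forall s \near F, `|c| / 2 <= `|f s|.
  apply: filterS (bO_small0 c2 hf) => s.
  have := ler_normB (f s) (f s - c); rewrite opprB addrC subrK; lra.
split; last exact: bO_inv ge.
by apply: filterS ge => s; rewrite -normr_gt0; apply: lt_le_trans.
Qed.

End BigO.

(* [bo_inf] infers the best exponent provable from the hypotheses, most recent first;
   [bo] then weakens it to the required one. *)
Ltac bo_inf :=
  cbv beta;
  lazymatch goal with
  | |- bO _ _ _ (fun s => ?f s) => change (fun s => f s) with f
  | _ => idtac end;
  match goal with
  | H : bO ?F ?tau _ ?f |- bO ?F ?tau _ ?f => exact H
  | |- bO _ ?tau _ ?tau => exact bO_scale
  | |- bO _ _ _ (fun=> ?c) => exact (bO_cst c)
  | |- bO _ _ _ (fun s => @?f s + @?g s) => refine (@bO_add _ _ _ _ _ _ _ f g _ _); bo_inf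
  | |- bO _ _ _ (fun s => - @?f s) => refine (@bO_opp _ _ _ _ _ _ f _); bo_inf
  | |- bO _ _ _ (fun s => @?f s * @?g s) => refine (@bO_mul _ _ _ _ _ _ _ f g _ _); bo_inf
  | |- bO _ _ _ (fun s => @?f s ^+ ?n) => refine (@bO_exp _ _ _ _ _ _ f n _); bo_inf
  end.

Ltac bo := refine (@bO_le _ _ _ _ _ _ _ _ _ _); [ | solve [bo_inf]]; first [done | lia].

(** * Splitting off the eigenvalue close to 1 *)

Section Decomposition.
Context {R : realType} (c1 c2 c3 c4 c5 : R).
Local Notation m g2 g3 := (2 * c2 * g2 - 2 * c3 * g3).
Local Notation l g2 g3 := (2 * c4 * g2 - 2 * c5 * g3).

(** [X = h z z^T - N] with [z = (1, x, y)] and [N z = 0], where [[a, b], [b, h y^2]] is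
    the lower block of [N]; its last entry is forced by [X 2 2 = 0]. *)
Definition decomp (p1 p2 p3 h x y a b : R) : Prop :=
  [/\ p1 = h * x + (x * a + y * b),
      p2 = - (h * y + (x * b + y * (h * y ^+ 2))),
      p3 = h * (x * y) - b,
      l p2 p3 = h * x ^+ 2 - a &
      1 - 2 * c1 * p1 + m p2 p3 =
        h - (x ^+ 2 * a + 2 * (x * y * b) + y ^+ 2 * (h * y ^+ 2))].

(* [h (1 + x^2 + y^2)] is the eigenvalue of [z]; the bounds single out the top one. *)
Definition top_range (h x y : R) : Prop := 1 / 2 <= h * (1 + x ^+ 2 + y ^+ 2) <= 2.

(** Since N z = 0, applying X to z leaves X z = h |z|^2 z. In this form the last two equations are
    linear in (x, y) once the eigenvalue e is known. *)
Lemma decomp_eigen p1 p2 p3 h x y a b : decomp p1 p2 p3 h x y a b <->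
  let e := h * (1 + x ^+ 2 + y ^+ 2) in
  [/\ a = h * x ^+ 2 - l p2 p3, b = h * (x * y) - p3,
      1 - 2 * c1 * p1 + m p2 p3 + p1 * x - p2 * y = e,
      p1 + l p2 p3 * x + p3 * y = e * x & - p2 + p3 * x = e * y].
Proof.
split=> [[e1 e2 e3 e4 e5]|/= [ea eb e1 e2 e3]].
  split=> /=.
  - rewrite e4; ring.
  - rewrite e3; ring.
  - rewrite e5 e1 e2; ring.
  - rewrite e4 e3 e1; ring.
  - rewrite e3 e2; ring.
have f1 : p1 = h * x + (x * a + y * b).
  rewrite ea eb; have := e2; lra.
have f2 : p2 = - (h * y + (x * b + y * (h * y ^+ 2))).
  rewrite eb; have := e3; lra.
split=> //.
- by rewrite eb; ring.
- by rewrite ea; ring.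
- have -> : 1 - 2 * c1 * p1 + m p2 p3 = h * (1 + x ^+ 2 + y ^+ 2) - p1 * x + p2 * y.
    by rewrite -e1; ring.
  by rewrite {1}f1 {1}f2; ring.
Qed.

Section Asymptotics.
Context {T : Type} {F : set_system T} {tau : T -> R} {S : Scale F tau}.
Local Notation O := (bO F tau).
Variables P1 P2 P3 : T -> R.
Hypotheses (O1 : O 1 P1) (O2 : O 1 P2) (O3 : O 1 P3).

Lemma decomp_exists : \forall s \near F, exists h x y a b,
  decomp (P1 s) (P2 s) (P3 s) h x y a b /\ top_range h x y.
Proof.
(* [phi e s] is det(e - X), expanded along the first row: [D] is the lower 2x2 minor, and [dx / D],
   [dy / D] solve the last two eigenvector equations by Cramer's rule. *)
pose D e s := (e - l (P2 s) (P3 s)) * e - P3 s ^+ 2.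
pose dx e s := P1 s * e - P2 s * P3 s.
pose dy e s := - (e - l (P2 s) (P3 s)) * P2 s + P3 s * P1 s.
pose X11 s := 1 - 2 * c1 * P1 s + m (P2 s) (P3 s).
pose phi e s := (e - X11 s) * D e s - P1 s * dx e s + P2 s * dy e s.
have lim e : O 1 (fun s => phi e s - (e - 1) * e ^+ 2).
  apply: (bO_eq (fun s => (2 * c1 * P1 s - m (P2 s) (P3 s)) * D e s
     - (e - 1) * (l (P2 s) (P3 s) * e + P3 s ^+ 2) - P1 s * dx e s + P2 s * dy e s)).
    by apply: nearW => s; rewrite /phi /X11 /D; ring.
  rewrite /D /dx /dy; bo.
have limD : O 1 (fun s => 2 * l (P2 s) (P3 s) + P3 s ^+ 2) by bo.
have limL : O 1 (fun s => l (P2 s) (P3 s)) by bo.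
have e0 : 0 < 1 / 100 :> R by lra.
near=> s.
have h1 : `|phi (1 / 2) s - (1 / 2 - 1) * (1 / 2) ^+ 2| <= 1 / 100.
  by near: s; exact: bO_small0.
have h2 : `|phi 2 s - (2 - 1) * 2 ^+ 2| <= 1 / 100 by near: s; exact: bO_small0.
have hD : `|l (P2 s) (P3 s)| <= 1 / 100 by near: s; exact: bO_small0.
have hD2 : `|P3 s| <= 1 / 100 by near: s; exact: bO_small0.
pose lq := (l (P2 s) (P3 s))%:P.
pose p : {poly R} := ('X - (X11 s)%:P) * (('X - lq) * 'X - (P3 s ^+ 2)%:P)
  - (P1 s)%:P * ((P1 s)%:P * 'X - (P2 s * P3 s)%:P)
  + (P2 s)%:P * (- ('X - lq) * (P2 s)%:P + (P3 s * P1 s)%:P).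
have pE e : p.[e] = phi e s by rewrite /p /lq !hornerE /phi /D /dx /dy; ring.
(* In the limit the polynomial is (e - 1) e^2, with values -1/8 and 4 at the endpoints. *)
have [||e /andP[e1 e2] /rootP] := @poly_ivt R p (1 / 2) 2; first by lra.
  rewrite !pE; move: h1 h2; rewrite !ler_norml; lra.
rewrite pE => phi0.
have De : D e s != 0.
  rewrite gt_eqF// /D; move: hD hD2; rewrite !ler_norml => *; nra.
pose x := dx e s / D e s; pose y := dy e s / D e s.
pose h := e / (1 + x ^+ 2 + y ^+ 2).
have n0 : 0 < 1 + x ^+ 2 + y ^+ 2 by rewrite -addrA ltr_wpDr// addr_ge0// sqr_ge0.
have he : h * (1 + x ^+ 2 + y ^+ 2) = e by rewrite divfK// gt_eqF.
exists h, x, y, (h * x ^+ 2 - l (P2 s) (P3 s)), (h * (x * y) - P3 s).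
split; last by rewrite /top_range he e1 e2.
apply/decomp_eigen; rewrite he; split=> //.
- apply/eqP; rewrite -subr_eq0; apply/eqP.
  transitivity (- phi e s / D e s); last by rewrite phi0 oppr0 mul0r.
  by rewrite /x /y /phi /X11; field.
- by apply/eqP; rewrite -subr_eq0; apply/eqP; rewrite /x /y /dx /dy /D; field.
- by apply/eqP; rewrite -subr_eq0; apply/eqP; rewrite /x /y /dx /dy /D; field.
Unshelve. all: by end_near.
Qed.

Variables H X Y A B : T -> R.
Hypothesis dec : \forall s \near F, decomp (P1 s) (P2 s) (P3 s) (H s) (X s) (Y s) (A s) (B s).
Hypothesis top : \forall s \near F, top_range (H s) (X s) (Y s).

(** The range of the eigenvalue is the only a priori information. It keeps e and the minor [D] away
    from 0, so Cramer's rule bounds x, the last eigenvector equation y, and the remaining equations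
    h, a and b. *)
Lemma decomp_bO : [/\ O 1 X, O 1 Y, O 1 (fun s => H s - 1), O 1 A & O 1 B].
Proof.
pose E s := H s * (1 + X s ^+ 2 + Y s ^+ 2).
pose D s := (E s - l (P2 s) (P3 s)) * E s - P3 s ^+ 2.
have OE : O 0 E.
  exists 2; apply: filterS top => s; rewrite /top_range -/(E s) expr0 mulr1 => /andP[h1 h2].
  by rewrite ger0_norm//; lra.
have OE' : O 0 (fun s => (E s)^-1).
  have h2 : 0 < 1 / 2 :> R by lra.
  apply: (bO_inv h2); apply: filterS top => s /andP[h1 _].
  by rewrite (le_trans h1)// ler_norm.
have OD : O 1 (fun s => l (P2 s) (P3 s) * E s + P3 s ^+ 2) by bo.
have h8 : 0 < 1 / 8 :> R by lra.
have geD : \forall s \near F, 1 / 8 <= D s.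
  apply: filterS2 (bO_small0 h8 OD) top => s.
  by rewrite /top_range -/(E s) /D ler_norml => /andP[_ h1] /andP[h2 _]; nra.
have D0 : \forall s \near F, D s != 0.
  by apply: filterS geD => s hs; rewrite gt_eqF//; lra.
have E0 : \forall s \near F, E s != 0.
  by apply: filterS top => s /andP[hs _]; rewrite gt_eqF// /E; lra.
have OD' : O 0 (fun s => (D s)^-1).
  by apply: (bO_inv h8); apply: filterS geD => s /le_trans; apply; rewrite ler_norm.
have OX : O 1 X.
  apply: (bO_eq (fun s => (P1 s * E s - P2 s * P3 s) * (D s)^-1)); last by bo.
  apply: filterS2 D0 dec => s D0 /decomp_eigen[_ _ _ e2 e3].
  apply: (mulIf D0); rewrite divfK// /D.
  move: e2 e3; rewrite -/(E s) => e2 e3.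
  have := congr1 (fun z => z * E s) e2; have := congr1 (fun z => z * P3 s) e3.
  by rewrite /=; lra.
have OY : O 1 Y.
  apply: (bO_eq (fun s => (- P2 s + P3 s * X s) * (E s)^-1)); last by bo.
  by apply: filterS2 E0 dec => s E0 /decomp_eigen[_ _ _ _ ->]; rewrite -/(E s) mulrC mulKf.
have OH0 : O 0 H.
  exists 2; apply: filterS top => s /andP[h1 h2].
  have n1 : 1 <= 1 + X s ^+ 2 + Y s ^+ 2 by rewrite -addrA lerDl addr_ge0// sqr_ge0.
  have H0 : 0 <= H s by rewrite -(pmulr_lge0 _ (lt_le_trans ltr01 n1)); lra.
  rewrite expr0 mulr1 ger0_norm// (le_trans _ h2)//.
  by rewrite ler_peMr.
have OH : O 1 (fun s => H s - 1).
  apply: (bO_eq (fun s => - 2 * c1 * P1 s + m (P2 s) (P3 s) + P1 s * X s - P2 s * Y s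
    - H s * (X s ^+ 2 + Y s ^+ 2))); last by bo.
  by apply: filterS dec => s /decomp_eigen[_ _ /= e1 _ _]; lra.
split=> //.
- apply: (bO_eq (fun s => H s * X s ^+ 2 - l (P2 s) (P3 s))); last by bo.
  by apply: filterS dec => s /decomp_eigen[].
- apply: (bO_eq (fun s => H s * (X s * Y s) - P3 s)); last by bo.
  by apply: filterS dec => s /decomp_eigen[].
Qed.

End Asymptotics.
End Decomposition.

(** * Expansion of one step *)

Section Step.
Context {R : realType} (c1 c2 c3 c4 c5 : R).
Hypothesis c4_neq0 : c4 != 0.
Local Notation m g2 g3 := (2 * c2 * g2 - 2 * c3 * g3).
Local Notation l g2 g3 := (2 * c4 * g2 - 2 * c5 * g3).
Local Notation W := (1 + 2 * c1 ^+ 2).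

(** [g1 B1 + g2 B2 + g3 B3] is the orthogonal projection of [N] onto the direction of [E]:
    the residual is orthogonal to [B1], [B2] and [B3]. *)
Definition normal_eqs (h x y a b g1 g2 g3 : R) : Prop :=
  let n11 := x ^+ 2 * a + 2 * (x * y * b) + y ^+ 2 * (h * y ^+ 2) in
  let n12 := - (x * a + y * b) in
  let n13 := - (x * b + y * (h * y ^+ 2)) in
  let e := - 2 * c1 * g1 + m g2 g3 - n11 in
  [/\ g1 - n12 = c1 * e,
      c2 * e + g2 + n13 + c4 * (l g2 g3 - a) = 0 &
      - c3 * e - c5 * (l g2 g3 - a) + (g3 - b) = 0].

Lemma W_gt0 : 0 < W. Proof. by rewrite ltr_wpDr// mulr_ge0// sqr_ge0. Qed.
Let W0 : W != 0. Proof. by rewrite gt_eqF// W_gt0. Qed.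

(** The coefficient of tau^6 in a. It is k^3 / c4 with k = 1 / (2 c4), the coefficient in y ~ - k
    tau^2. *)
Definition rate6 : R := (8 * c4 ^+ 4)^-1.

Context {T : Type} {F : set_system T} {tau : T -> R} {S : Scale F tau}.
Local Notation O := (bO F tau).
Variables P1 P2 P3 H X Y A B G1 G2 G3 : T -> R.
Hypotheses (O2 : O 1 P2) (O3 : O 1 P3) (OG2 : O 7 G2) (OG3 : O 7 G3).
Hypothesis tauE : \forall s \near F, P1 s = tau s + c1 * m (P2 s) (P3 s) / W.
Hypothesis dec : \forall s \near F,
  decomp c1 c2 c3 c4 c5 (P1 s) (P2 s) (P3 s) (H s) (X s) (Y s) (A s) (B s).
Hypothesis top : \forall s \near F, top_range (H s) (X s) (Y s).
Hypothesis nor : \forall s \near F,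
  normal_eqs (H s) (X s) (Y s) (A s) (B s) (G1 s) (G2 s) (G3 s).

(** With [G2] and [G3] of order 7, the last two normal equations express a and b through strictly
    smaller terms, so each substitution gains a power of tau until h y^3 and the order 7 stop it. *)
Lemma step_bO : [/\ O 2 P2, O 3 P3, O 1 (fun s => H s - 1) & O 1 X] /\
 [/\ O 2 Y, O 6 A, O 6 B & O 7 G1] /\
 [/\ O 7 (fun s => A s - rate6 * tau s ^+ 6),
     O 5 (fun s => H s * Y s ^+ 2 - (2 * c4) ^- 2 * tau s ^+ 4) &
     O 8 (fun s => G1 s - c1 * m (G2 s) (G3 s) / W + rate6 / W * tau s ^+ 7)].
Proof.
have O1 : O 1 P1 by apply: bO_eq tauE _; bo.
have [OX OY OH OA OB] := decomp_bO c1 c2 c3 c4 c5 P1 P2 P3 O1 O2 O3 H X Y A B dec top.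
have OH0 : O 0 H by apply: (bO_eq (fun s => (H s - 1) + 1)); [apply: nearW => s; ring|bo].
pose N11 s := X s ^+ 2 * A s + 2 * (X s * Y s * B s) + Y s ^+ 2 * (H s * Y s ^+ 2).
pose N12 s := - (X s * A s + Y s * B s).
pose N13 s := - (X s * B s + Y s * (H s * Y s ^+ 2)).
(* The residual e of the normal equations, with [G1] eliminated by the first of them. *)
pose E s := (m (G2 s) (G3 s) - N11 s - 2 * c1 * N12 s) * W^-1.
have EE : \forall s \near F, - 2 * c1 * G1 s + m (G2 s) (G3 s) - N11 s = E s.
  apply: filterS nor => s [/= e1 _ _]; rewrite /E; apply: (mulIf W0).
  have := congr1 (fun z => c1 * z) e1; rewrite divfK//= -/(N11 s) -/(N12 s); lra.
have AE : \forall s \near F,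
    A s = c4^-1 * (c2 * E s + G2 s + N13 s) + l (G2 s) (G3 s).
  apply: filterS2 nor EE => s [/= _ e2 _]; rewrite -/(N11 s) => e1.
  move: e2; rewrite -/(N11 s) e1 -/(N13 s) => e2.
  apply: (mulfI c4_neq0); rewrite mulrDr mulVKf//; lra.
have BE : \forall s \near F,
    B s = G3 s - c5 * l (G2 s) (G3 s) + c5 * A s - c3 * E s.
  apply: filterS2 nor EE => s [/= _ _ e3]; rewrite -/(N11 s) => e1.
  by move: e3; rewrite -/(N11 s) e1; lra.
(* Three sources limit the gain: [G2] and [G3] (order 7), products of a and b with x or y (order j +
   1), and h y^3 in [N13] (order 3 i). *)
have improve i j : O i Y -> O j A -> O j B ->
    O (minn 7 (minn j.+1 (3 * i))) A /\ O (minn 7 (minn j.+1 (3 * i))) B.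
  move=> OYi OAj OBj.
  have OA' : O (minn 7 (minn j.+1 (3 * i))) A.
    apply: bO_eq AE _; rewrite /E /N11 /N12 /N13; bo.
  split=> //; apply: bO_eq BE _; clear OAj.
  rewrite /E /N11 /N12; bo.
have [OA2 OB2] : O 2 A /\ O 2 B := improve 1 1 OY OA OB.
have {OA2 OB2} [OA3 OB3] : O 3 A /\ O 3 B := improve 1 2 OY OA2 OB2.
have OP3 : O 2 P3.
  apply: (bO_eq (fun s => H s * (X s * Y s) - B s)); last by bo.
  by apply: filterS dec => s [].
have OP2 : O 2 P2.
  apply: (bO_eq (fun s => (2 * c4)^-1 * (H s * X s ^+ 2 - A s + 2 * c5 * P3 s))); last by bo.
  by apply: filterS dec => s [_ _ _ <- _]; field.
have OY2 : O 2 Y.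
  apply: (bO_eq (fun s => - (P2 s + X s * B s + H s * Y s ^+ 3) - (H s - 1) * Y s)); last by bo.
  by apply: filterS dec => s [_ -> _ _ _]; ring.
clear OY.
(* Now that y has order 2, the limit set by h y^3 is 6, and three more rounds reach it. *)
have {OA3 OB3} [OA4 OB4] : O 4 A /\ O 4 B := improve 2 3 OY2 OA3 OB3.
have {OA4 OB4} [OA5 OB5] : O 5 A /\ O 5 B := improve 2 4 OY2 OA4 OB4.
have {OA5 OB5} [OA6 OB6] : O 6 A /\ O 6 B := improve 2 5 OY2 OA5 OB5.
clear improve OA OB.
have {}OP3 : O 3 P3.
  apply: (bO_eq (fun s => H s * (X s * Y s) - B s)); last by bo.
  by apply: filterS dec => s [].
have XE : O 2 (fun s => X s - tau s).
  apply: (bO_eq (fun s => c1 * m (P2 s) (P3 s) / W - (H s - 1) * X s - X s * A s - Y s * B s)).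
    by apply: filterS2 dec tauE => s [e1 _ _ _ _]; rewrite e1; lra.
  clear O2 O3; bo.
pose k2 : R := (2 * c4)^-1.
have P2E : O 3 (fun s => P2 s - k2 * tau s ^+ 2).
  apply: (bO_eq (fun s => k2 * ((H s - 1) * X s ^+ 2 + (X s - tau s) * (X s + tau s)
      - A s + 2 * c5 * P3 s))); last by clear O3; bo.
  apply: filterS dec => s [_ _ _ e4 _]; rewrite /k2.
  have -> : P2 s = (H s * X s ^+ 2 - A s + 2 * c5 * P3 s) / (2 * c4) by rewrite -e4; field.
  by field.
have YE : O 3 (fun s => Y s + k2 * tau s ^+ 2).
  apply: (bO_eq (fun s => - (P2 s - k2 * tau s ^+ 2) - X s * B s - H s * Y s ^+ 3
    - (H s - 1) * Y s)); last by bo.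
  by apply: filterS dec => s [_ -> _ _ _]; ring.
have Y3E : O 7 (fun s => H s * Y s ^+ 3 + k2 ^+ 3 * tau s ^+ 6).
  apply: (bO_eq (fun s => (H s - 1) * Y s ^+ 3 + (Y s + k2 * tau s ^+ 2) *
     (Y s ^+ 2 - Y s * (k2 * tau s ^+ 2) + k2 ^+ 2 * tau s ^+ 4))); last by bo.
  by apply: nearW => s; ring.
have DE : O 5 (fun s => H s * Y s ^+ 2 - k2 ^+ 2 * tau s ^+ 4).
  apply: (bO_eq (fun s => (H s - 1) * Y s ^+ 2 + (Y s + k2 * tau s ^+ 2) *
     (Y s - k2 * tau s ^+ 2))); last by bo.
  by apply: nearW => s; ring.
(* The leading term of a comes from - h y^3 / c4, that is k2^3 / c4 = [rate6]. *)
have A6 : O 7 (fun s => A s - rate6 * tau s ^+ 6).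
  apply: (bO_eq (fun s => c4^-1 * (c2 * E s + G2 s - X s * B s -
     (H s * Y s ^+ 3 + k2 ^+ 3 * tau s ^+ 6)) + l (G2 s) (G3 s))).
    apply: filterS AE => s ->; rewrite /N13 /k2 /rate6; by field.
  by rewrite /E /N11 /N12; bo.
have G1E : \forall s \near F,
    G1 s = N12 s + c1 * E s.
  by apply: filterS2 nor EE => s [/= e1 _ _]; rewrite -/(N11 s) => <-; rewrite -e1 /N12; ring.
have OG1 : O 7 G1 by apply: bO_eq G1E _; rewrite /E /N11 /N12; bo.
split; first by [].
split; first by [].
split; first by [].
- by rewrite exprVn in DE.
(* Subtracting c1 m / W from [G1] leaves ([N12] - c1 [N11]) / W, where only - X A has order exactly
   7. *)
apply: (bO_eq (fun s => - W^-1 * ((X s - tau s) * A s + tau s * (A s - rate6 * tau s ^+ 6)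
   + Y s * B s + c1 * N11 s))); last by rewrite /N11; bo.
by apply: filterS G1E => s ->; rewrite /E /N12; field.
Qed.
End Step.

(** * Contraction transversally to B1 *)

Section Contraction.
Context {R : realType} (c1 c2 c3 c4 c5 : R).
Hypothesis c4_neq0 : c4 != 0.
Local Notation m g2 g3 := (2 * c2 * g2 - 2 * c3 * g3).
Local Notation l g2 g3 := (2 * c4 * g2 - 2 * c5 * g3).
Local Notation W := (1 + 2 * c1 ^+ 2).
Let W0 : W != 0. Proof. by rewrite gt_eqF// W_gt0. Qed.

(** [full_form] is the squared norm of the part of [g1 B1 + g2 B2 + g3 B3] orthogonal to
    [B1] (it does not depend on [g1]); [tan_form] leaves out its lower 2x2 block, i.e.
    measures the component tangent at [Ustar] to the rank one matrices. *)
Definition tan_form (g2 g3 : R) : R := (m g2 g3) ^+ 2 / W + 2 * g2 ^+ 2.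
Definition full_form (g2 g3 : R) : R :=
  tan_form g2 g3 + (l g2 g3) ^+ 2 + 2 * g3 ^+ 2.

Lemma tan_form_ge0 g2 g3 : 0 <= tan_form g2 g3.
Proof.
apply: addr_ge0; last by rewrite mulr_ge0 ?sqr_ge0.
by apply: divr_ge0; rewrite ?sqr_ge0// ltW// W_gt0.
Qed.

Lemma full_form_ge0 g2 g3 : 0 <= full_form g2 g3.
Proof.
rewrite /full_form; have := tan_form_ge0 g2 g3; have := sqr_ge0 g3.
by have := sqr_ge0 (l g2 g3); lra.
Qed.

Lemma full_form_ge g2 g3 : 2 * g2 ^+ 2 <= full_form g2 g3 /\ 2 * g3 ^+ 2 <= full_form g2 g3.
Proof.
have h : 0 <= (m g2 g3) ^+ 2 / W by apply: divr_ge0; rewrite ?sqr_ge0// ltW// W_gt0.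
rewrite /full_form /tan_form; have := sqr_ge0 (l g2 g3).
by have := sqr_ge0 g3; have := sqr_ge0 g2; split; lra.
Qed.

(** As c4 != 0, the lower block (l, g3) determines g2, hence also m = al l + be g3. So [tan_form] is
    at most C times the squared norm of the block, and [full_form], the sum of the two, yields r^2 =
    C / (1 + C). *)
Lemma tan_form_lt : exists2 r : R, 0 <= r < 1 &
  forall g2 g3, tan_form g2 g3 <= r ^+ 2 * full_form g2 g3.
Proof.
pose al := c2 / c4; pose be := 2 * c2 * c5 / c4 - 2 * c3.
pose C := 2 * al ^+ 2 / W + be ^+ 2 / W + c4 ^- 2 + 2 * (c5 / c4) ^+ 2.
have W1 : 0 < W^-1 by rewrite invr_gt0 W_gt0.
have C0 : 0 <= C.
  have := mulr_ge0 (sqr_ge0 al) (ltW W1); have := mulr_ge0 (sqr_ge0 be) (ltW W1).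
  by have := sqr_ge0 c4^-1; have := sqr_ge0 (c5 / c4); rewrite exprVn /C; lra.
have tC g2 g3 : tan_form g2 g3 <= C * ((l g2 g3) ^+ 2 + 2 * g3 ^+ 2).
  have -> : tan_form g2 g3 = (al * l g2 g3 + be * g3) ^+ 2 / W
      + 2 * ((2 * c4)^-1 * l g2 g3 + c5 / c4 * g3) ^+ 2.
    rewrite /tan_form /al /be; field; by rewrite W0 c4_neq0.
  have q (u v : R) : (u + v) ^+ 2 <= 2 * u ^+ 2 + 2 * v ^+ 2.
    have := sqr_ge0 (u - v); lra.
  have h1 := q (al * l g2 g3) (be * g3).
  have h2 := q ((2 * c4)^-1 * l g2 g3) (c5 / c4 * g3).
  have h1' := ler_wpM2r (ltW W1) h1.
  apply: (le_trans (lerD h1' (ler_wpM2l _ h2))); first by lra.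
  rewrite /C -subr_ge0.
  have -> : (2 * al ^+ 2 / W + be ^+ 2 / W + c4 ^- 2 + 2 * (c5 / c4) ^+ 2) * ((l g2 g3) ^+ 2 + 2 * g3 ^+ 2) -
   ((2 * (al * l g2 g3) ^+ 2 + 2 * (be * g3) ^+ 2) / W +
    2 * (2 * ((2 * c4)^-1 * l g2 g3) ^+ 2 + 2 * (c5 / c4 * g3) ^+ 2))
   = W^-1 * (4 * (al * g3) ^+ 2 + (be * l g2 g3) ^+ 2)
     + 2 * (c4^-1 * g3) ^+ 2 + 2 * (c5 / c4 * l g2 g3) ^+ 2.
    by field; rewrite W0 c4_neq0.
  have := mulr_ge0 (ltW W1) (sqr_ge0 (al * g3)).
  have := mulr_ge0 (ltW W1) (sqr_ge0 (be * l g2 g3)).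
  by have := sqr_ge0 (c4^-1 * g3); have := sqr_ge0 (c5 / c4 * l g2 g3); lra.
exists (Num.sqrt (C / (1 + C))) => [|g2 g3].
  rewrite sqrtr_ge0/= -[ltRHS]sqrtr1 ltr_sqrt// ltr_pdivrMr ?mul1r; lra.
rewrite sqr_sqrtr ?divr_ge0//; last lra.
rewrite mulrAC ler_pdivlMr; last lra.
have := tC g2 g3; rewrite /full_form; lra.
Qed.

(* The projection of N tested against an arbitrary direction orthogonal to B1. *)
Lemma normal_eqs_form h x y a b g1 g2 g3 u2 u3 :
  normal_eqs c1 c2 c3 c4 c5 h x y a b g1 g2 g3 ->
  let n11 := x ^+ 2 * a + 2 * (x * y * b) + y ^+ 2 * (h * y ^+ 2) in
  let n12 := - (x * a + y * b) in
  let n13 := - (x * b + y * (h * y ^+ 2)) in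
  m u2 u3 * m g2 g3 / W + 2 * u2 * g2 + l u2 u3 * l g2 g3 + 2 * u3 * g3 =
  m u2 u3 / W * (n11 + 2 * c1 * n12) - 2 * u2 * n13 + l u2 u3 * a + 2 * u3 * b.
Proof.
move=> /=; rewrite /normal_eqs.
set n11 := x ^+ 2 * a + _ + _ * _; set n12 := - (x * a + _); set n13 := - (x * b + _).
set e := - 2 * c1 * g1 + _ - n11 => -[e1 e2 e3].
have eE : e = (m g2 g3 - n11 - 2 * c1 * n12) / W.
  apply: (mulIf W0); rewrite divfK//; have := congr1 (fun z => c1 * z) e1.
  rewrite /= {1}/e /e; lra.
have := congr1 (fun z => 2 * u2 * z) e2; have := congr1 (fun z => 2 * u3 * z) e3.
rewrite /= eE; lra.
Qed.

Context {T : Type} {F : set_system T} {tau : T -> R} {S : Scale F tau}.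
Local Notation O := (bO F tau).
Variables P1 P2 P3 H X Y A B G1 G2 G3 : T -> R.
Variables H' X' Y' A' B' G1' G2' G3' : T -> R.
Variable K : R.
Hypothesis K_gt0 : 0 < K.
Hypotheses (O2 : O 1 P2) (O3 : O 1 P3).
Hypothesis G_small : \forall s \near F, full_form (G2 s) (G3 s) <= (K * tau s ^+ 7) ^+ 2.
Hypothesis tauE : \forall s \near F, P1 s = tau s + c1 * m (P2 s) (P3 s) / W.
Hypothesis dec : \forall s \near F,
  decomp c1 c2 c3 c4 c5 (P1 s) (P2 s) (P3 s) (H s) (X s) (Y s) (A s) (B s).
Hypothesis top : \forall s \near F, top_range (H s) (X s) (Y s).
Hypothesis nor : \forall s \near F,
  normal_eqs c1 c2 c3 c4 c5 (H s) (X s) (Y s) (A s) (B s) (G1 s) (G2 s) (G3 s).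
Hypothesis dec' : \forall s \near F,
  decomp c1 c2 c3 c4 c5 (P1 s + G1 s) (P2 s + G2 s) (P3 s + G3 s)
    (H' s) (X' s) (Y' s) (A' s) (B' s).
Hypothesis top' : \forall s \near F, top_range (H' s) (X' s) (Y' s).
Hypothesis nor' : \forall s \near F,
  normal_eqs c1 c2 c3 c4 c5 (H' s) (X' s) (Y' s) (A' s) (B' s) (G1' s) (G2' s) (G3' s).

Lemma full_form_bO : O 7 G2 /\ O 7 G3.
Proof.
have aux (u : R) s : 0 < tau s < 1 -> 2 * u ^+ 2 <= (K * tau s ^+ 7) ^+ 2 ->
    `|u| <= K * tau s ^+ 7.
  move=> /andP[t0 _] hu.
  have K0 : 0 <= K * tau s ^+ 7 by rewrite mulr_ge0 ?exprn_ge0// ltW.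
  rewrite -(@ler_pXn2r _ 2) ?nnegrE// real_normK ?num_real//.
  have := sqr_ge0 u; lra.
split; exists K; apply: filterS2 G_small (scaleP 1 ltr01) => s hs t01; apply: aux => //;
 have [h1 h2] := full_form_ge (G2 s) (G3 s); exact: le_trans hs.
Qed.

(** Both normal equations are tested against the new step and subtracted. As the lower block of N
    changes by minus that of the old step, what remains is the inner product of the tangential parts
    plus terms of order 8; Cauchy-Schwarz and [tan_form_lt] conclude. *)
Lemma full_form_contracts : \forall s \near F,
  full_form (G2' s) (G3' s) <=
  (K * (tau s + (G1 s - c1 * m (G2 s) (G3 s) / W)) ^+ 7) ^+ 2.
Proof.
have [OG2 OG3] := full_form_bO.
have [[OP2 OP3 OH OX] [[OY OA OB OG1] _]] :=
  step_bO c1 c2 c3 c4 c5 c4_neq0 P1 P2 P3 H X Y A B G1 G2 G3 O2 O3 OG2 OG3 tauE dec top nor.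
have OP1 : O 1 P1 by apply: bO_eq tauE _; clear O2 O3; bo.
have [|||OX' OY' OH' OA' OB'] := decomp_bO c1 c2 c3 c4 c5 _ _ _ _ _ _ H' X' Y' A' B' dec' top'.
- by bo.
- by bo.
- by bo.
have OH0 : O 0 H by apply: (bO_eq (fun s => (H s - 1) + 1)); [apply: nearW => s; ring|bo].
have OH0' : O 0 H' by apply: (bO_eq (fun s => (H' s - 1) + 1)); [apply: nearW => s; ring|bo].
(* Exact increments between consecutive states: [Z22], [Z23], [DD] for h x^2, h x y, h y^2; [DA],
   [DB] for a, b; [Z11], [Z12], [Z13] for the first row of N. *)
pose DX s := X' s - X s; pose DY s := Y' s - Y s; pose DH s := H' s - H s.
pose Z22 s := DH s * X' s ^+ 2 + H s * (X' s + X s) * DX s.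
pose Z23 s := DH s * (X' s * Y' s) + H s * DX s * Y' s + H s * X s * DY s.
pose DD s := DH s * Y' s ^+ 2 + H s * (Y' s + Y s) * DY s.
pose DA s := Z22 s - l (G2 s) (G3 s).
pose DB s := Z23 s - G3 s.
pose Z11 s := X' s ^+ 2 * DA s + DX s * (X' s + X s) * A s
  + 2 * (X' s * Y' s * DB s + (DX s * Y' s + X s * DY s) * B s)
  + Y' s ^+ 2 * DD s + DY s * (Y' s + Y s) * (H s * Y s ^+ 2).
pose Z12 s := - (X' s * DA s + DX s * A s + Y' s * DB s + DY s * B s).
pose Z13 s := - (X' s * DB s + DX s * B s + Y' s * DD s + DY s * (H s * Y s ^+ 2)).
have EA : \forall s \near F, A' s = A s + DA s.
  apply: filterS2 dec dec' => s [_ _ _ e _] [_ _ _ e' _].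
  by rewrite /DA /Z22 /DH /DX; lra.
have EB : \forall s \near F, B' s = B s + DB s.
  apply: filterS2 dec dec' => s [_ _ e _ _] [_ _ e' _ _].
  by rewrite /DB /Z23 /DH /DX /DY; lra.
have EH : \forall s \near F, DH s = - 2 * c1 * G1 s + m (G2 s) (G3 s) + Z11 s.
  apply: filterS3 EA EB (filterI dec dec') => s ea eb [[_ _ _ _ e] [_ _ _ _ e']].
  by move: e'; rewrite ea eb /Z11 /DA /DB /Z22 /Z23 /DD /DH /DX /DY; lra.
have EX : \forall s \near F, DX s = G1 s + Z12 s - DH s * X' s - (H s - 1) * DX s.
  apply: filterS3 EA EB (filterI dec dec') => s ea eb [[e _ _ _ _] [e' _ _ _ _]].
  by move: e'; rewrite ea eb /Z12 /DA /DB /Z22 /Z23 /DH /DX /DY; lra.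
have EY : \forall s \near F, DY s = - G2 s + Z13 s - DH s * Y' s - (H s - 1) * DY s.
  apply: filterS3 EA EB (filterI dec dec') => s ea eb [[_ e _ _ _] [_ e' _ _ _]].
  by move: e'; rewrite eb /Z13 /DB /Z23 /DD /DH /DX /DY; lra.
(* Every increment on the right comes with a factor of order 1, so one power is gained per round
   until the terms [G1], [G2], [G3] of order 7 dominate. *)
have gain j : (j <= 6)%N -> O j DX /\ O j DY /\ O j DH -> O j.+1 DX /\ O j.+1 DY /\ O j.+1 DH.
  move=> j6 [ODX [ODY ODH]].
  have OZ11 : O j.+1 Z11 by rewrite /Z11 /DA /DB /DD /Z22 /Z23; bo.
  have OZ12 : O j.+1 Z12 by rewrite /Z12 /DA /DB /DD /Z22 /Z23; bo.
  have OZ13 : O j.+1 Z13 by rewrite /Z13 /DA /DB /DD /Z22 /Z23; bo.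
  by split; [|split]; [apply: bO_eq EX _|apply: bO_eq EY _|apply: bO_eq EH _]; bo.
have [ODX [ODY ODH]] : O 7 DX /\ O 7 DY /\ O 7 DH.
  suff h1 : O 1 DX /\ O 1 DY /\ O 1 DH.
    exact: gain 6 isT (gain 5 isT (gain 4 isT (gain 3 isT (gain 2 isT (gain 1 isT h1))))).
  split; [|split].
  - by rewrite /DX; bo.
  - by rewrite /DY; bo.
  - by apply: (bO_eq (fun s => (H' s - 1) - (H s - 1))); [apply: nearW => s; rewrite /DH; ring|bo].
have OZ22 : O 8 Z22 by rewrite /Z22; bo.
have OZ23 : O 8 Z23 by rewrite /Z23; bo.
have OZ11 : O 8 Z11 by rewrite /Z11 /DA /DB /DD; bo.
have OZ12 : O 8 Z12 by rewrite /Z12 /DA /DB /DD; bo.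
have OZ13 : O 8 Z13 by rewrite /Z13 /DA /DB /DD; bo.
clear gain.
(* The coefficients of [G2'] and [G3'] in the subtracted equations, apart from the linear response
   to the lower block. *)
pose V2 s := 2 * c2 / W * (Z11 s + 2 * c1 * Z12 s) - 2 * Z13 s + 2 * c4 * Z22 s.
pose V3 s := - (2 * c3) / W * (Z11 s + 2 * c1 * Z12 s) - 2 * c5 * Z22 s + 2 * Z23 s.
have OV2 : O 8 V2 by rewrite /V2; bo.
have OV3 : O 8 V3 by rewrite /V3; bo.
have QE : \forall s \near F, full_form (G2' s) (G3' s) =
    m (G2' s) (G3' s) * m (G2 s) (G3 s) / W + 2 * G2' s * G2 s + G2' s * V2 s + G3' s * V3 s.
  near=> s.
  have ea : A' s = A s + DA s by near: s.
  have eb : B' s = B s + DB s by near: s.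
  have n : normal_eqs c1 c2 c3 c4 c5 (H s) (X s) (Y s) (A s) (B s) (G1 s) (G2 s) (G3 s).
    by near: s.
  have n' : normal_eqs c1 c2 c3 c4 c5 (H' s) (X' s) (Y' s) (A' s) (B' s) (G1' s) (G2' s) (G3' s).
    by near: s.
  have /= := normal_eqs_form _ _ _ _ _ _ _ _ (G2' s) (G3' s) n.
  have /= := normal_eqs_form _ _ _ _ _ _ _ _ (G2' s) (G3' s) n'.
  rewrite /full_form /tan_form ea eb /V2 /V3 /Z11 /Z12 /Z13 /DA /DB /DD /Z22 /Z23 /DX /DY /DH.
  by lra.
have [r /andP[r0 r1] hr] := tan_form_lt.
(* The gap 1 - r pays for the errors: a share d each for the terms with [V2] and [V3], and another
   for the change of tau^7. *)
pose d := (1 - r) / 4.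
have d0 : 0 < d * K by rewrite mulr_gt0// /d; lra.
pose tau' s := tau s + (G1 s - c1 * m (G2 s) (G3 s) / W).
have Otau : O 8 (fun s => tau' s ^+ 7 - tau s ^+ 7).
  apply: (bO_eq (fun s => (tau' s - tau s) * (tau' s ^+ 6 + tau' s ^+ 5 * tau s +
    tau' s ^+ 4 * tau s ^+ 2 + tau' s ^+ 3 * tau s ^+ 3 + tau' s ^+ 2 * tau s ^+ 4
    + tau' s * tau s ^+ 5 + tau s ^+ 6))).
    by apply: nearW => s; ring.
  have OD : O 7 (fun s => tau' s - tau s).
    apply: (bO_eq (fun s => G1 s - c1 * m (G2 s) (G3 s) / W)); last by bo.
    by apply: nearW => s; rewrite /tau'; ring.
  have Ot : O 1 tau' by rewrite /tau'; bo.
  by bo.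
have d1 : 0 < (1 - r) / 4 by lra.
near=> s.
have t01 : 0 < tau s < 1 by near: s; exact: scaleP.
have t7 : 0 < tau s ^+ 7 by rewrite exprn_gt0//; case/andP: t01.
have hV2 : `|V2 s| <= (d * K) * tau s ^+ 7 by near: s; exact: bO_small.
have hV3 : `|V3 s| <= (d * K) * tau s ^+ 7 by near: s; exact: bO_small.
have ht : `|tau' s ^+ 7 - tau s ^+ 7| <= (1 - r) / 4 * tau s ^+ 7 by near: s; exact: bO_small.
have hG : full_form (G2 s) (G3 s) <= (K * tau s ^+ 7) ^+ 2 by near: s.
have hQ : full_form (G2' s) (G3' s) =
    m (G2' s) (G3' s) * m (G2 s) (G3 s) / W + 2 * G2' s * G2 s + G2' s * V2 s + G3' s * V3 s.
  by near: s.
rewrite -/(tau' s).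
set n := Num.sqrt (full_form (G2' s) (G3' s)).
have n0 : 0 <= n by exact: sqrtr_ge0.
have nE : full_form (G2' s) (G3' s) = n ^+ 2 by rewrite sqr_sqrtr// full_form_ge0.
have le_n (u : R) : 2 * u ^+ 2 <= full_form (G2' s) (G3' s) -> `|u| <= n.
  move=> hu; rewrite -(@ler_pXn2r _ 2) ?nnegrE// real_normK ?num_real// -nE.
  have := sqr_ge0 u; lra.
have [/le_n g2n /le_n g3n] := full_form_ge (G2' s) (G3' s).
have M0 : 0 < K * tau s ^+ 7 by rewrite mulr_gt0.
have CS : m (G2' s) (G3' s) * m (G2 s) (G3 s) / W + 2 * G2' s * G2 s
    <= n * (r * (K * tau s ^+ 7)).
  apply: (le_trans (ler_norm _)).
  have rM : 0 <= n * (r * (K * tau s ^+ 7)).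
    by apply: mulr_ge0 => //; apply: mulr_ge0 => //; exact: ltW.
  rewrite -(@ler_pXn2r _ 2) ?nnegrE// real_normK ?num_real//.
  have le1 : tan_form (G2' s) (G3' s) <= n ^+ 2.
    rewrite -nE /full_form; have := sqr_ge0 (l (G2' s) (G3' s)).
    have := sqr_ge0 (G3' s); lra.
  have le2 : tan_form (G2 s) (G3 s) <= r ^+ 2 * (K * tau s ^+ 7) ^+ 2.
    by apply: (le_trans (hr _ _)); rewrite ler_wpM2l// sqr_ge0.
  have le3 := ler_pM (tan_form_ge0 _ _) (tan_form_ge0 _ _) le1 le2.
  rewrite exprMn [(r * _) ^+ 2]exprMn; apply: le_trans le3; rewrite -subr_ge0.
  have -> : tan_form (G2' s) (G3' s) * tan_form (G2 s) (G3 s)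
     - (m (G2' s) (G3' s) * m (G2 s) (G3 s) / W + 2 * G2' s * G2 s) ^+ 2 =
     2 * (m (G2' s) (G3' s) * G2 s - m (G2 s) (G3 s) * G2' s) ^+ 2 / W.
    by rewrite /tan_form; field.
  by apply: divr_ge0; [rewrite mulr_ge0 ?sqr_ge0|rewrite ltW// W_gt0].
have hn : n <= (r + 2 * d) * (K * tau s ^+ 7).
  have [n_le0|n_gt0] := leP n 0.
    by rewrite (le_trans n_le0)// mulr_ge0 ?(ltW M0)// /d; lra.
  rewrite -(ler_pM2l n_gt0) -expr2 -nE hQ.
  have le_mul (u v D : R) : `|u| <= n -> `|v| <= D -> u * v <= n * D.
    by move=> hu hv; rewrite (le_trans (ler_norm _))// normrM ler_pM.
  have := le_mul _ _ _ g2n hV2; have := le_mul _ _ _ g3n hV3.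
  by move: CS; lra.
rewrite nE; have le : n <= K * tau' s ^+ 7.
  apply: (le_trans hn); rewrite mulrCA ler_pM2l//.
  have : 0 < (1 - r) * tau s ^+ 7 by rewrite mulr_gt0//; lra.
  by move: ht; rewrite ler_norml /d => /andP[ht _]; lra.
by rewrite ler_pXn2r ?nnegrE// (le_trans n0).
Unshelve. all: by end_near.
Qed.
End Contraction.

(** * The two projections in coordinates *)

Section Iteration.
Context {R : realType} (c1 c2 c3 c4 c5 : R).
Local Notation m g2 g3 := (2 * c2 * g2 - 2 * c3 * g3).
Local Notation l g2 g3 := (2 * c4 * g2 - 2 * c5 * g3).
Local Notation W := (1 + 2 * c1 ^+ 2).
Let W0 : W != 0. Proof. by rewrite gt_eqF// W_gt0. Qed.

Definition pt (p1 p2 p3 : R) : 'M[R]_3 :=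
  Ustar R + p1 *: B1 c1 + p2 *: B2 c2 c4 + p3 *: B3 c3 c5.

Definition vec3 (u v w : R) : 'cV[R]_3 := \col_i nth 0 [:: u; v; w] i.

Lemma ptE p1 p2 p3 : pt p1 p2 p3 =
  mx3 [:: [:: 1 - 2 * c1 * p1 + m p2 p3; p1; - p2];
          [:: p1; l p2 p3; p3];
          [:: - p2; p3; 0]].
Proof.
apply/matrixP => -[[|[|[|//]]] hi] [[|[|[|//]]] hj]; rewrite !mxE /=; ring.
Qed.

Lemma frob_dot_mx3 (A B : 'M[R]_3) : frob_dot A B =
  A 0 0 * B 0 0 + A 0 1 * B 0 1 + A 0 2 * B 0 2 +
  (A 1 0 * B 1 0 + A 1 1 * B 1 1 + A 1 2 * B 1 2) +
  (A 2 0 * B 2 0 + A 2 1 * B 2 1 + A 2 2 * B 2 2).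
Proof.
rewrite frob_dotE !big_ord_recl !big_ord0 !addr0.
have -> : lift ord0 ord0 = 1 :> 'I_3 by exact/val_inj.
have -> : lift ord0 (lift ord0 ord0) = 2 :> 'I_3 by exact/val_inj.
by rewrite !addrA.
Qed.

Lemma proj_psd_decomp p1 p2 p3 h x y a b :
  decomp c1 c2 c3 c4 c5 p1 p2 p3 h x y a b ->
  0 <= h -> 0 < h * y ^+ 2 -> b ^+ 2 <= a * (h * y ^+ 2) ->
  Defs.proj (@psd_cone R 3) (pt p1 p2 p3) = h *: (vec3 1 x y *m (vec3 1 x y)^T).
Proof.
move=> [e1 e2 e3 e4 e5] h0 d0 bad; set d := h * y ^+ 2.
have dn0 : d != 0 by rewrite gt_eqF.
(* Completing the square in the lower block of N; the first coordinates make both vectors orthogonal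
   to z. *)
have NE : h *: (vec3 1 x y *m (vec3 1 x y)^T) - pt p1 p2 p3 =
   \sum_(uv <- [:: (d, vec3 (- y - b / d * x) (b / d) 1); (a - b ^+ 2 / d, vec3 (- x) 1 0)])
     uv.1 *: (uv.2 *m uv.2^T).
  rewrite ptE !big_cons big_nil addr0 /=.
  apply/matrixP => -[[|[|[|//]]] hi] [[|[|[|//]]] hj]; rewrite !mxE !big_ord1 !mxE /=
   ?e5 ?e4 ?e3 ?e2 ?e1 -?/d;
  by field.
apply: (proj_psd_eq _ _ _ _ NE).
- split=> [|v]; first by rewrite linearZ /= trmx_mul trmxK.
  have -> : v^T *m (h *: (vec3 1 x y *m (vec3 1 x y)^T)) *m v =
     h *: ((v^T *m vec3 1 x y) *m (v^T *m vec3 1 x y)^T).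
    by rewrite -scalemxAr -scalemxAl trmx_mul trmxK !mulmxA.
  by rewrite !mxE big_ord1 [_^T ord0 0]mxE mulr_ge0// -expr2 sqr_ge0.
- move=> uv; rewrite !inE => /orP[] /eqP -> /=; first exact: ltW.
  by rewrite subr_ge0 ler_pdivrMr.
- rewrite ptE frob_dot_mx3 !mxE !big_ord1 !mxE /= e5 e4 e3 e2 e1; ring.
Qed.

Lemma proj_affine p1 p2 p3 h x y a b g1 g2 g3 :
  decomp c1 c2 c3 c4 c5 p1 p2 p3 h x y a b ->
  normal_eqs c1 c2 c3 c4 c5 h x y a b g1 g2 g3 ->
  Defs.proj (affineE c1 c2 c3 c4 c5) (h *: (vec3 1 x y *m (vec3 1 x y)^T)) =
  pt (p1 + g1) (p2 + g2) (p3 + g3).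
Proof.
move=> [f1 f2 f3 f4 f5] [/= e1 e2 e3]; apply: proj_eq.
  by exists (p1 + g1), (p2 + g2), (p3 + g3).
move=> Z [r1 [r2 [r3 ->]]]; rewrite -/(pt r1 r2 r3) le_eqVlt; apply/orP; left.
apply/eqP/esym; rewrite !ptE frob_dot_mx3 !mxE !big_ord1 !mxE /=.
(* In the coordinates d of the test direction, the orthogonality is the sum of the hypotheses with
   the multipliers given below. *)
have [d1 d1E] : exists d, p1 + g1 - r1 = d by exists (p1 + g1 - r1).
have [d2 d2E] : exists d, p2 + g2 - r2 = d by exists (p2 + g2 - r2).
have [d3 d3E] : exists d, p3 + g3 - r3 = d by exists (p3 + g3 - r3).
have -> : r1 = p1 + g1 - d1 by rewrite -d1E; ring.
have -> : r2 = p2 + g2 - d2 by rewrite -d2E; ring.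
have -> : r3 = p3 + g3 - d3 by rewrite -d3E; ring.
have := congr1 (fun z => z * d1) e1; have := congr1 (fun z => z * d2) e2.
have := congr1 (fun z => z * d3) e3; have := congr1 (fun z => z * d1) f1.
have := congr1 (fun z => z * d2) f2; have := congr1 (fun z => z * d3) f3.
have := congr1 (fun z => z * l d2 d3) f4.
have := congr1 (fun z => z * (- 2 * c1 * d1 + m d2 d3)) f5.
by clear; rewrite /=; lra.
Qed.

(** Eliminating g1 leaves a 2x2 system whose matrix is half the Gram matrix of [full_form]; its
    determinant [D] is at least 1. *)
Lemma normal_exists h x y a b :
  exists g1 g2 g3, normal_eqs c1 c2 c3 c4 c5 h x y a b g1 g2 g3.
Proof.
pose n11 := x ^+ 2 * a + 2 * (x * y * b) + y ^+ 2 * (h * y ^+ 2).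
pose n12 := - (x * a + y * b).
pose n13 := - (x * b + y * (h * y ^+ 2)).
pose k := (n11 + 2 * c1 * n12) / W.
pose t2 := c4 * a - n13 + c2 * k; pose t3 := b - c5 * a - c3 * k.
pose al := 1 + 2 * c2 ^+ 2 / W + 2 * c4 ^+ 2.
pose be := 1 + 2 * c3 ^+ 2 / W + 2 * c5 ^+ 2.
pose ga := 2 * c2 * c3 / W + 2 * c4 * c5.
pose D := al * be - ga ^+ 2.
have D0 : D != 0.
  have -> : D = 1 + 2 * (c2 ^+ 2 / W) + 2 * c4 ^+ 2 + 2 * (c3 ^+ 2 / W) + 2 * c5 ^+ 2
      + 4 * ((c2 * c5 - c3 * c4) ^+ 2 / W).
    by rewrite /D /al /be /ga; field.
  have W1 : 0 <= W^-1 by rewrite invr_ge0 ltW// W_gt0.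
  have := mulr_ge0 (sqr_ge0 c2) W1; have := mulr_ge0 (sqr_ge0 c3) W1.
  have := mulr_ge0 (sqr_ge0 (c2 * c5 - c3 * c4)) W1.
  by have := sqr_ge0 c4; have := sqr_ge0 c5; move=> *; rewrite gt_eqF//; lra.
pose g2 := (be * t2 + ga * t3) / D; pose g3 := (ga * t2 + al * t3) / D.
pose e := (m g2 g3 - n11 - 2 * c1 * n12) / W.
have q2 : al * g2 - ga * g3 = t2 by rewrite /g2 /g3 /D; field.
have q3 : be * g3 - ga * g2 = t3 by rewrite /g2 /g3 /D; field.
exists (n12 + c1 * e), g2, g3.
have eE : - 2 * c1 * (n12 + c1 * e) + m g2 g3 - n11 = e.
  by rewrite /e; field.
rewrite /normal_eqs -/n11 -/n12 -/n13 eE.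
have eE' : e = m g2 g3 / W - k by rewrite /e /k; field.
split; first by ring.
- by rewrite eE'; move: q2; rewrite /al /ga /t2; lra.
- by rewrite eE'; move: q3; rewrite /be /ga /t3; lra.
Qed.
End Iteration.

(** * The invariant tube *)

(** The filter of [tau -> 0+] uniformly over [D]. *)
Definition to0 {R : realType} {T : Type} (D : set T) (tau : T -> R) : set_system T :=
  [set P | exists2 e : R, 0 < e & forall s, D s -> 0 < tau s < e -> P s].

Section To0.
Context {R : realType} {T : Type} (D : set T) (tau : T -> R).

Lemma to0_filter : Filter (to0 D tau).
Proof.
split.
- by exists 1.
- move=> P Q [e e0 hP] [f f0 hQ]; exists (Num.min e f); first by rewrite lt_min e0.
  move=> s Ds /andP[t0]; rewrite lt_min => /andP[te tf].
  by split; [apply: hP|apply: hQ]; rewrite ?t0.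
- by move=> P Q PQ [e e0 hP]; exists e => // s Ds /(hP s Ds)/PQ.
Qed.

#[global] Instance to0_scale : Scale (to0 D tau) tau.
Proof. by split; [exact: to0_filter|move=> e e0; exists e]. Qed.

Lemma to0_dom (P : T -> Prop) : (forall s, D s -> P s) -> \forall s \near to0 D tau, P s.
Proof. by move=> h; exists 1 => // s /h. Qed.
End To0.

Section OneStep.
Context {R : realType} (c1 c2 c3 c4 c5 : R).
Hypothesis c4_neq0 : c4 != 0.
Local Notation m g2 g3 := (2 * c2 * g2 - 2 * c3 * g3).
Local Notation W := (1 + 2 * c1 ^+ 2).
Let W0 : W != 0. Proof. by rewrite gt_eqF// W_gt0. Qed.

(** Bundling a point with its decomposition and its step turns all these quantities into functions
    on one type, to which the O-calculus applies without choosing eigenvectors. *)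
Record state := State { sp1 : R; sp2 : R; sp3 : R; sh : R; sx : R; sy : R;
  sa : R; sb : R; sg1 : R; sg2 : R; sg3 : R }.

Definition valid (s : state) : Prop :=
  [/\ decomp c1 c2 c3 c4 c5 (sp1 s) (sp2 s) (sp3 s) (sh s) (sx s) (sy s) (sa s) (sb s),
      top_range (sh s) (sx s) (sy s) &
      normal_eqs c1 c2 c3 c4 c5 (sh s) (sx s) (sy s) (sa s) (sb s) (sg1 s) (sg2 s) (sg3 s)].

(** The coefficient of [B1] in the orthogonal projection of [X - Ustar] onto [B1]. *)
Definition b1_coord (p1 p2 p3 : R) : R := p1 - c1 * m p2 p3 / W.
Definition height (s : state) : R := b1_coord (sp1 s) (sp2 s) (sp3 s).
Definition next_height (s : state) : R :=
  b1_coord (sp1 s + sg1 s) (sp2 s + sg2 s) (sp3 s + sg3 s).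

(** The essential condition bounds the next step and not the position. The crude bounds on [sp2] and
    [sp3] only start the bootstrap, which improves them to orders 2 and 3. *)
Definition tube (K : R) : set state := [set s |
  [/\ valid s, `|sp2 s| <= height s, `|sp3 s| <= height s &
      full_form c1 c2 c3 c4 c5 (sg2 s) (sg3 s) <= (K * height s ^+ 7) ^+ 2]].

Definition follows (s s' : state) : Prop :=
  [/\ sp1 s' = sp1 s + sg1 s, sp2 s' = sp2 s + sg2 s & sp3 s' = sp3 s + sg3 s].

Lemma next_heightE s :
  next_height s = height s + (sg1 s - c1 * m (sg2 s) (sg3 s) / W).
Proof. by rewrite /next_height /height /b1_coord; field. Qed.

Lemma valid_exists {T : Type} {F : set_system T} {tau : T -> R} {S : Scale F tau}
    (P1 P2 P3 : T -> R) : bO F tau 1 P1 -> bO F tau 1 P2 -> bO F tau 1 P3 ->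
  \forall t \near F, exists s, valid s /\ [/\ sp1 s = P1 t, sp2 s = P2 t & sp3 s = P3 t].
Proof.
move=> O1 O2 O3; apply: filterS (decomp_exists c1 c2 c3 c4 c5 P1 P2 P3 O1 O2 O3).
move=> t [h [x [y [a [b [hd ht]]]]]].
have [g1 [g2 [g3 hn]]] := normal_exists c1 c2 c3 c4 c5 h x y a b.
by exists (State (P1 t) (P2 t) (P3 t) h x y a b g1 g2 g3); split.
Qed.

Section Tube.
Variable K : R.
Hypothesis K_gt0 : 0 < K.
Local Notation F := (to0 (tube K) height).
Local Notation O := (bO F height).

Lemma tube_bO : [/\ O 1 sp2, O 1 sp3, O 7 sg2 & O 7 sg3].
Proof.
have [|OG2 OG3] := @full_form_bO _ c1 c2 c3 c4 c5 _ F height _ sg2 sg3 K K_gt0.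
  by apply: to0_dom => s [_ _ _].
by split=> //; exists 1; apply: to0_dom => s [_ h2 h3 _]; rewrite expr1 mul1r.
Qed.

Lemma tube_heightE : \forall s \near F, sp1 s = height s + c1 * m (sp2 s) (sp3 s) / W.
Proof. by apply: nearW => s; rewrite /height /b1_coord subrK. Qed.

Lemma tube_step_bO : [/\ O 2 sp2, O 3 sp3, O 1 (fun s => sh s - 1) & O 1 sx] /\
 [/\ O 2 sy, O 6 sa, O 6 sb & O 7 sg1] /\
 [/\ O 7 (fun s => sa s - rate6 c4 * height s ^+ 6),
     O 5 (fun s => sh s * sy s ^+ 2 - (2 * c4) ^- 2 * height s ^+ 4) &
     O 8 (fun s => sg1 s - c1 * m (sg2 s) (sg3 s) / W + rate6 c4 / W * height s ^+ 7)].
Proof.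
have [ O2 O3 OG2 OG3] := tube_bO.
apply: (step_bO c1 c2 c3 c4 c5 c4_neq0 sp1 sp2 sp3 sh sx sy sa sb sg1 sg2 sg3) => //.
- exact: tube_heightE.
- by apply: to0_dom => s [[]].
- by apply: to0_dom => s [[]].
- by apply: to0_dom => s [[]].
Qed.

(** A comparison of orders: a (h y^2) is a positive multiple of q^10 to leading order, whereas b^2
    has order 12. *)
Lemma tube_psd : \forall s \near F,
  [/\ 0 <= sh s, 0 < sh s * sy s ^+ 2 & sb s ^+ 2 <= sa s * (sh s * sy s ^+ 2)].
Proof.
have [[_ _ OH _] [[_ _ OB _] [OA OD _]]] := tube_step_bO.
have k0 : 0 < rate6 c4 / 2.
  by rewrite divr_gt0// /rate6 invr_gt0 mulr_gt0// exprn_even_gt0.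
have d0 : 0 < (2 * c4) ^- 2 / 2.
  by rewrite divr_gt0// invr_gt0 exprn_even_gt0//= mulf_neq0// pnatr_eq0.
have OB2 : O 11 (fun s => sb s ^+ 2) by bo.
have kd0 := mulr_gt0 k0 d0.
near=> s.
have /andP[t0 t1] : 0 < height s < 1 by near: s; exact: scaleP.
have hH : `|sh s - 1| <= 1 / 2 by near: s; apply: bO_small0 => //; lra.
have hA : `|sa s - rate6 c4 * height s ^+ 6| <= rate6 c4 / 2 * height s ^+ 6.
  by near: s; exact: bO_small.
have hD : `|sh s * sy s ^+ 2 - (2 * c4) ^- 2 * height s ^+ 4|
   <= (2 * c4) ^- 2 / 2 * height s ^+ 4 by near: s; exact: bO_small.
have hB : `|sb s ^+ 2| <= (rate6 c4 / 2 * ((2 * c4) ^- 2 / 2)) * height s ^+ 10.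
  by near: s; exact: bO_small.
have t4 : 0 < height s ^+ 4 by rewrite exprn_gt0.
have t6 : 0 < height s ^+ 6 by rewrite exprn_gt0.
have leA : rate6 c4 / 2 * height s ^+ 6 <= sa s by move: hA; rewrite ler_norml; lra.
have leD : (2 * c4) ^- 2 / 2 * height s ^+ 4 <= sh s * sy s ^+ 2.
  by move: hD; rewrite ler_norml; lra.
split.
- by move: hH; rewrite ler_norml; lra.
- by apply: lt_le_trans leD; rewrite mulr_gt0.
- apply: (le_trans (ler_norm _)); apply: (le_trans hB).
  apply: (@le_trans _ _ ((rate6 c4 / 2 * height s ^+ 6) * ((2 * c4) ^- 2 / 2 * height s ^+ 4))).
    by rewrite le_eqVlt; apply/orP; left; apply/eqP; rewrite [RHS]mulrACA -exprD.
  by apply: ler_pM => //; rewrite ltW// mulr_gt0.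
Unshelve. all: by end_near.
Qed.

Lemma tube_contraction : \forall s \near F,
  forall s', valid s' -> follows s s' ->
  full_form c1 c2 c3 c4 c5 (sg2 s') (sg3 s') <= (K * next_height s ^+ 7) ^+ 2.
Proof.
(* A filter on pairs makes the threshold uniform in the successor as well. *)
pose D2 : set (state * state) := [set ss | [/\ tube K ss.1, valid ss.2 & follows ss.1 ss.2]].
pose tau2 (ss : state * state) := height ss.1.
have [ O2 O3] : bO (to0 D2 tau2) tau2 1 (sp2 \o fst) /\ bO (to0 D2 tau2) tau2 1 (sp3 \o fst).
  by split; exists 1; apply: to0_dom => s [[_ h2 h3 _] _ _]; rewrite expr1 mul1r.
have [||||||||e e0 he] := full_form_contracts c1 c2 c3 c4 c5 c4_neq0 (F := to0 D2 tau2) (tau := tau2)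
  (sp1 \o fst) (sp2 \o fst) (sp3 \o fst) (sh \o fst) (sx \o fst) (sy \o fst)
  (sa \o fst) (sb \o fst) (sg1 \o fst) (sg2 \o fst) (sg3 \o fst)
  (sh \o snd) (sx \o snd) (sy \o snd)
  (sa \o snd) (sb \o snd) (sg1 \o snd) (sg2 \o snd) (sg3 \o snd) K K_gt0 O2 O3.
- by apply: to0_dom => -[s s'] [[_ _ _ h] _ _].
- by apply: nearW => -[s s']; rewrite /tau2 /height /b1_coord /= subrK.
- by apply: to0_dom => -[s s'] [[[h _ _] _ _ _] _ _].
- by apply: to0_dom => -[s s'] [[[_ h _] _ _ _] _ _].
- by apply: to0_dom => -[s s'] [[[_ _ h] _ _ _] _ _].
- by apply: to0_dom => -[s s'] [_ [h _ _] [/= e1 e2 e3]]; rewrite /= -e1 -e2 -e3.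
- by apply: to0_dom => -[s s'] [_ [_ h _] _].
- by apply: to0_dom => -[s s'] [_ [_ _ h] _].
exists e => // s ts hs s' vs' ss'.
by rewrite next_heightE; apply: (he (s, s')).
Qed.

Lemma tube_step : exists e C : R, 0 < e /\ forall s, tube K s -> 0 < height s < e ->
  [/\ Defs.proj (affineE c1 c2 c3 c4 c5)
        (Defs.proj (@psd_cone R 3) (pt c1 c2 c3 c4 c5 (sp1 s) (sp2 s) (sp3 s))) =
        pt c1 c2 c3 c4 c5 (sp1 s + sg1 s) (sp2 s + sg2 s) (sp3 s + sg3 s),
      0 < next_height s <= height s - rate6 c4 / W / 2 * height s ^+ 7,
      `|next_height s - height s + rate6 c4 / W * height s ^+ 7| <= C * height s ^+ 8,
      `|sp2 s| <= C * height s ^+ 2 /\ `|sp3 s| <= C * height s ^+ 2 &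
      exists2 s', tube K s' & follows s s'].
Proof.
have [ O2 O3 OG2 OG3] := tube_bO.
have [[ O22 O33 _ _] [[_ _ _ OG1] [_ _ OG]]] := tube_step_bO.
have [C1 C1_gt0 h1] := bO_pos OG.
have [C2 C2_gt0 h2] := bO_pos O22.
have O32 : O 2 sp3 by clear O3; bo.
have [C3 C3_gt0 h3] := bO_pos O32.
have O1 : O 1 sp1 by apply: bO_eq tube_heightE _; bo.
have k0 : 0 < rate6 c4 / W / 2.
  by rewrite !divr_gt0 ?W_gt0// /rate6 invr_gt0 mulr_gt0// exprn_even_gt0.
have half : 0 < 1 / 2 :> R by lra.
have Op2 : O 2 (fun s => sp2 s + sg2 s) by bo.
have Op3 : O 2 (fun s => sp3 s + sg3 s) by bo.
have OD : O 2 (fun s => sg1 s - c1 * m (sg2 s) (sg3 s) / W) by bo.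
suff [e e0 he] : \forall s \near F,
  [/\ Defs.proj (affineE c1 c2 c3 c4 c5)
        (Defs.proj (@psd_cone R 3) (pt c1 c2 c3 c4 c5 (sp1 s) (sp2 s) (sp3 s))) =
        pt c1 c2 c3 c4 c5 (sp1 s + sg1 s) (sp2 s + sg2 s) (sp3 s + sg3 s),
      0 < next_height s <= height s - rate6 c4 / W / 2 * height s ^+ 7,
      `|next_height s - height s + rate6 c4 / W * height s ^+ 7| <= (C1 + C2 + C3) * height s ^+ 8,
      `|sp2 s| <= (C1 + C2 + C3) * height s ^+ 2 /\ `|sp3 s| <= (C1 + C2 + C3) * height s ^+ 2 &
      exists2 s', tube K s' & follows s s'].
  by exists e, (C1 + C2 + C3); split.
near=> s.
have /andP[t0 t1] : 0 < height s < 1 by near: s; exact: scaleP.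
have vs : valid s by near: s; apply: to0_dom => s [vs _ _ _].
have [dec top nor] := vs.
have [H0 D0 BAD] : [/\ 0 <= sh s, 0 < sh s * sy s ^+ 2 & sb s ^+ 2 <= sa s * (sh s * sy s ^+ 2)].
  by near: s; exact: tube_psd.
have hG : `|sg1 s - c1 * m (sg2 s) (sg3 s) / W + rate6 c4 / W * height s ^+ 7|
   <= C1 * height s ^+ 8 by near: s.
have hG' : `|sg1 s - c1 * m (sg2 s) (sg3 s) / W + rate6 c4 / W * height s ^+ 7|
   <= rate6 c4 / W / 2 * height s ^+ 7 by near: s; exact: bO_small.
have hD : `|sg1 s - c1 * m (sg2 s) (sg3 s) / W| <= 1 / 2 * height s ^+ 1.
  by near: s; exact: bO_small.
have hp2 : `|sp2 s + sg2 s| <= 1 / 2 * height s ^+ 1 by near: s; exact: bO_small.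
have hp3 : `|sp3 s + sg3 s| <= 1 / 2 * height s ^+ 1 by near: s; exact: bO_small.
have h2s : `|sp2 s| <= C2 * height s ^+ 2 by near: s.
have h3s : `|sp3 s| <= C3 * height s ^+ 2 by near: s.
have [s' [vs' ss']] : exists s', valid s' /\ follows s s'.
  near: s; apply: (valid_exists (fun s => sp1 s + sg1 s) (fun s => sp2 s + sg2 s)
    (fun s => sp3 s + sg3 s)); bo.
have hQ : forall s', valid s' -> follows s s' ->
  full_form c1 c2 c3 c4 c5 (sg2 s') (sg3 s') <= (K * next_height s ^+ 7) ^+ 2.
  by near: s; exact: tube_contraction.
have hs' : height s' = next_height s by rewrite /height /next_height; have [-> -> ->] := ss'.
have t2 : 0 < height s ^+ 2 by rewrite exprn_gt0.
have t7 : 0 < height s ^+ 7 by rewrite exprn_gt0.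
have t8 : 0 < height s ^+ 8 by rewrite exprn_gt0.
have n_ge : 1 / 2 * height s <= next_height s.
  by move: hD; rewrite next_heightE expr1 ler_norml; lra.
split.
- rewrite (proj_psd_decomp _ _ _ _ _ _ _ _ _ _ _ _ _ dec H0 D0 BAD).
  exact: proj_affine dec nor.
- apply/andP; split; first by lra.
  by move: hG'; rewrite next_heightE ler_norml; lra.
- have -> : next_height s - height s = sg1 s - c1 * m (sg2 s) (sg3 s) / W.
    by rewrite next_heightE addrC addKr.
  by rewrite (le_trans hG)// ler_pM2r//; lra.
- by split; [rewrite (le_trans h2s)|rewrite (le_trans h3s)]; rewrite // ler_pM2r//; lra.
- exists s' => //; split; rewrite ?hs' //; last exact: hQ.
  + by have [_ -> _] := ss'; move: hp2; rewrite expr1; lra.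
  + by have [_ _ ->] := ss'; move: hp3; rewrite expr1; lra.
Unshelve. all: by end_near.
Qed.
End Tube.
End OneStep.

(** * The initial curve *)

Section StartCurve.
Context {R : realType} (c1 c2 c3 c4 c5 : R).
Hypothesis c4_neq0 : c4 != 0.
Local Notation m g2 g3 := (2 * c2 * g2 - 2 * c3 * g3).
Local Notation l g2 g3 := (2 * c4 * g2 - 2 * c5 * g3).

Section Curve.
Context {T : Type} {F : set_system T} {tau : T -> R} {S : Scale F tau}.
Local Notation O := (bO F tau).
Local Notation ww := (fun s => w c1 c2 c3 c4 c5 (tau s)).
Local Notation g13' := (fun s => g13 c1 c2 c3 c4 c5 (tau s)).
Local Notation g23' := (fun s => g23 c1 c2 c3 c4 c5 (tau s)).
Local Notation dw := (fun s => 2 * c4 * w c1 c2 c3 c4 c5 (tau s) + 2 * c5 * tau s).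

(** On the curve h ~ w, h x ~ t and h y ~ - [g13], so the last two estimates prescribe the leading
    terms of a and b, namely those forced by a transverse step of order 7. [w] solves w = 1 - 2 c1 t
    + m up to order 5, which makes the error in t^2 / w of order 7. *)
Lemma curve_bO :
  [/\ O 2 g13', O 3 g23', O 1 (fun s => ww s - 1) &
      O 5 (fun s => ww s - (1 - 2 * c1 * tau s + m (g13' s) (g23' s)))] /\
  [/\ O 7 (fun s => tau s ^+ 2 / ww s - l (g13' s) (g23' s) - rate6 c4 * tau s ^+ 6) &
      O 7 (fun s => - (tau s * g13' s / ww s) - g23' s - c5 * rate6 c4 * tau s ^+ 6)].
Proof.
pose i1 s := c4 * (1 - 2 * c1 * tau s) + c5 * tau s.
have [i1n i1O] : (\forall s \near F, i1 s != 0) /\ O 0 (fun s => (i1 s)^-1).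
  apply: (bO_inv1 c4_neq0);
    apply: (bO_eq (fun s => - (2 * c1 * c4) * tau s + c5 * tau s)); last by bo.
  by apply: nearW => s; rewrite /i1; ring.
(* [wa] and [wb] are the approximations of w nested in its own denominators. Their errors of order 3
   get multiplied by at least tau^2. *)
pose wa s := 1 - 2 * c1 * tau s + c2 * tau s ^+ 2 / i1 s + c3 * tau s ^+ 3 / c4.
have waO : O 1 (fun s => wa s - 1).
  apply: (bO_eq (fun s => - (2 * c1 * tau s) + c2 * tau s ^+ 2 / i1 s + c3 * tau s ^+ 3 / c4)); last by bo.
  by apply: nearW => s; rewrite /wa; ring.
pose i2 s := c4 * wa s + c5 * tau s.
have [i2n i2O] : (\forall s \near F, i2 s != 0) /\ O 0 (fun s => (i2 s)^-1).
  apply: (bO_inv1 c4_neq0);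
    apply: (bO_eq (fun s => c4 * (wa s - 1) + c5 * tau s)); last by bo.
  by apply: nearW => s; rewrite /i2; ring.
pose wb s := 1 - 2 * c1 * tau s + c2 * tau s ^+ 2 / c4.
have wbO : O 1 (fun s => wb s - 1).
  apply: (bO_eq (fun s => - (2 * c1 * tau s) + c2 * tau s ^+ 2 / c4)); last by bo.
  by apply: nearW => s; rewrite /wb; ring.
have wbO0 : O 0 wb by rewrite /wb; bo.
pose i3 s := (c4 * wb s + c5 * tau s) * wb s.
have [i3n i3O] : (\forall s \near F, i3 s != 0) /\ O 0 (fun s => (i3 s)^-1).
  apply: (bO_inv1 c4_neq0);
    apply: (bO_eq (fun s => c4 * (wb s - 1) * (wb s + 1) + c5 * tau s * wb s)); last by bo.
  by apply: nearW => s; rewrite /i3; ring.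
have wE s : ww s = 1 - 2 * c1 * tau s + c2 * tau s ^+ 2 / i2 s + c3 * tau s ^+ 3 / i3 s by [].
pose v s := ww s.
have vE s : v s = 1 - 2 * c1 * tau s + c2 * tau s ^+ 2 / i2 s + c3 * tau s ^+ 3 / i3 s := wE s.
have vO : O 1 (fun s => v s - 1).
  apply: (bO_eq (fun s => - (2 * c1 * tau s) + c2 * tau s ^+ 2 / i2 s + c3 * tau s ^+ 3 / i3 s)); last by bo.
  by apply: nearW => s; rewrite vE; ring.
have vO0 : O 0 v by apply: (bO_eq (fun s => (v s - 1) + 1)); [apply: nearW => s; ring|bo].
have [vn vO'] := bO_inv1 (oner_neq0 R) vO.
pose i4 s := 2 * c4 * v s + 2 * c5 * tau s.
have c42 : 2 * c4 != 0 by rewrite mulf_neq0// pnatr_eq0.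
have i4E : O 1 (fun s => i4 s - 2 * c4).
  apply: (bO_eq (fun s => 2 * c4 * (v s - 1) + 2 * c5 * tau s)); last by bo.
  by apply: nearW => s; rewrite /i4; ring.
have [i4n i4O] := bO_inv1 c42 i4E.
have w_wa : O 3 (fun s => v s - wa s).
  apply: (bO_eq (fun s => c2 * tau s ^+ 2 * (i1 s - i2 s) * (i1 s)^-1 * (i2 s)^-1
     + c3 * tau s ^+ 3 * ((i3 s)^-1 - c4^-1))).
    by apply: filterS3 i1n i2n i3n => s h1 h2 h3; rewrite vE /wa; field; rewrite ?h1 ?h2 ?h3 ?c4_neq0.
  have d : O 1 (fun s => i1 s - i2 s).
    apply: (bO_eq (fun s => - (2 * c1 * c4) * tau s - c4 * (wa s - 1))); last by bo.
    by apply: nearW => s; rewrite /i1 /i2; ring.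
  by bo.
have w_wb : O 3 (fun s => v s - wb s).
  apply: (bO_eq (fun s => c2 * tau s ^+ 2 * (c4 - i2 s) * c4^-1 * (i2 s)^-1
     + c3 * tau s ^+ 3 * (i3 s)^-1)).
    by apply: filterS2 i2n i3n => s h2 h3; rewrite vE /wb; field; rewrite ?h2 ?h3 ?c4_neq0.
  have d : O 1 (fun s => c4 - i2 s).
    apply: (bO_eq (fun s => - c5 * tau s - c4 * (wa s - 1))); last by bo.
    by apply: nearW => s; rewrite /i2; ring.
  by bo.
pose gt s := tau s ^+ 2 / i4 s - 2 * (2 * c5 ^+ 2 + 1) * tau s ^+ 6 * (i4 s)^-1 ^+ 5.
pose k13 := c5 / c4 * r0 c1 c2 c3 c4 c5
  + frob_dot (B2 c2 c4) (B1 c1) / (16 * c4 ^+ 6 * frob_norm (B1 c1) ^+ 2).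
pose k23 := r0 c1 c2 c3 c4 c5.
have g13E s : g13' s = gt s + k13 * tau s ^+ 7.
  by rewrite /g13 /gt13 /r13 -/(i4 s) /gt /k13 exprVn; ring.
pose r s := - (2 * c5 * tau s ^+ 6 * ((i4 s)^-1 ^+ 4 * (v s)^-1)) + k23 * tau s ^+ 7.
have g23E s : g23' s = - (gt s / v s) * tau s + r s.
  by rewrite /g23 /gt13 /r23 -/(v s) -/(i4 s) /gt /r /k23 !exprVn (invfM (i4 s ^+ 4)).
have gtO : O 2 gt by rewrite /gt; bo.
have g13O : O 2 g13' by apply: (bO_eq (fun s => gt s + k13 * tau s ^+ 7)); [exact: nearW g13E|bo].
have g23O : O 3 g23'.
  by apply: (bO_eq (fun s => - (gt s / v s) * tau s + r s)); [exact: nearW g23E|rewrite /r; bo].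
(* The order 6 corrections in [g13] and [g23] are tuned to leave 2 tau^6 / (i4^4 v), once with the
   factor c5; the limit coefficient is 2 / (2 c4)^4 = [rate6]. *)
have i16 : O 1 (fun s => 2 * (i4 s)^-1 ^+ 4 * (v s)^-1 - rate6 c4).
  apply: (bO_eq (fun s => - (i4 s)^-1 ^+ 4 * (v s)^-1 * rate6 c4 *
     ((i4 s - 2 * c4) * (i4 s + 2 * c4) * (i4 s ^+ 2 + 4 * c4 ^+ 2) * v s
      + 16 * c4 ^+ 4 * (v s - 1)))).
    apply: filterS2 i4n vn => s h4 hv; rewrite /rate6; field.
    by rewrite h4 hv c4_neq0.
  have i4O0 : O 0 i4 by rewrite /i4; bo.
  by bo.
split; first split => //.
- apply: (bO_eq (fun s =>
    c2 * tau s ^+ 2 * (2 * c4) * (v s - wa s) * (i2 s)^-1 * (i4 s)^-1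
    + c3 * tau s ^+ 3 * ((2 * c4) * (v s - wb s) * (v s + wb s)
        + 2 * c5 * tau s * (v s - wb s)) * (i3 s)^-1 * (i4 s)^-1 * (v s)^-1
    - 2 * c2 * (- 2 * (2 * c5 ^+ 2 + 1) * tau s ^+ 6 * (i4 s)^-1 ^+ 5 + k13 * tau s ^+ 7)
    + 2 * c3 * (2 * (2 * c5 ^+ 2 + 1) * tau s ^+ 6 * (i4 s)^-1 ^+ 5 / v s * tau s + r s))).
    near=> s.
    have h2 : i2 s != 0 by near: s.
    have h3 : i3 s != 0 by near: s.
    have h4 : i4 s != 0 by near: s.
    have hv : v s != 0 by near: s.
    rewrite g13E g23E -/(v s) vE -vE.
    have -> : v s - (1 - 2 * c1 * tau s + m (gt s + k13 * tau s ^+ 7) (- (gt s / v s) * tau s + r s))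
      = c2 * tau s ^+ 2 / i2 s + c3 * tau s ^+ 3 / i3 s -
        m (gt s + k13 * tau s ^+ 7) (- (gt s / v s) * tau s + r s) by rewrite {1}vE; ring.
    have e2 : i4 s - 2 * i2 s = 2 * c4 * (v s - wa s) by rewrite /i4 /i2; ring.
    have e3 : i4 s * v s - 2 * i3 s =
      (2 * c4) * (v s - wb s) * (v s + wb s) + 2 * c5 * tau s * (v s - wb s).
      by rewrite /i4 /i3; ring.
    rewrite -e3 -(mulrA (c2 * tau s ^+ 2)) -e2 /gt; field.
    by rewrite h2 h3 h4 hv.
  have rO : O 6 r by rewrite /r; bo.
  by bo.
split.
- apply: (bO_eq (fun s => (2 * (i4 s)^-1 ^+ 4 * (v s)^-1 - rate6 c4) * tau s ^+ 6
     - 2 * c4 * k13 * tau s ^+ 7 + 2 * c5 * k23 * tau s ^+ 7)); last by bo.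
  apply: filterS2 i4n vn => s h4 hv; rewrite g13E g23E -/(v s) /gt /r.
  have -> : 2 * c4 = (i4 s - 2 * c5 * tau s) / v s by rewrite /i4; field.
  by field; rewrite h4 hv.
- apply: (bO_eq (fun s => c5 * (2 * (i4 s)^-1 ^+ 4 * (v s)^-1 - rate6 c4) * tau s ^+ 6
     - tau s * k13 * tau s ^+ 7 / v s - k23 * tau s ^+ 7)); last by bo.
  apply: filterS2 i4n vn => s h4 hv; rewrite g13E g23E -/(v s) /gt /r.
  by field; rewrite h4 hv.
Unshelve. all: by end_near.
Qed.
End Curve.
End StartCurve.

Section StartInTube.
Context {R : realType} (c1 c2 c3 c4 c5 : R).
Hypothesis c4_neq0 : c4 != 0.
Local Notation m g2 g3 := (2 * c2 * g2 - 2 * c3 * g3).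
Local Notation l g2 g3 := (2 * c4 * g2 - 2 * c5 * g3).
Local Notation W := (1 + 2 * c1 ^+ 2).

Section CurveState.
Context {T : Type} {F : set_system T} {tau : T -> R} {S : Scale F tau}.
Local Notation O := (bO F tau).
Variables P2 P3 H X Y A B G1 G2 G3 : T -> R.
Hypothesis P2E : forall s, P2 s = g13 c1 c2 c3 c4 c5 (tau s).
Hypothesis P3E : forall s, P3 s = g23 c1 c2 c3 c4 c5 (tau s).
Hypothesis dec : \forall s \near F,
  decomp c1 c2 c3 c4 c5 (tau s) (P2 s) (P3 s) (H s) (X s) (Y s) (A s) (B s).
Hypothesis top : \forall s \near F, top_range (H s) (X s) (Y s).
Hypothesis nor : \forall s \near F,
  normal_eqs c1 c2 c3 c4 c5 (H s) (X s) (Y s) (A s) (B s) (G1 s) (G2 s) (G3 s).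

(** [step_bO] does not apply, since a transverse step of order 7 is what has to be shown. Instead, h
    x = t - Q and h = al + N11 reduce a and b to the expressions of [curve_bO], with remainders [RA]
    and [RB]. *)
Lemma curve_AB_bO : [/\ O 2 P2, O 3 P3 & O 2 Y] /\
  [/\ O 7 (fun s => A s - rate6 c4 * tau s ^+ 6),
      O 7 (fun s => B s - c5 * rate6 c4 * tau s ^+ 6),
      O 1 X & O 1 (fun s => H s - 1)].
Proof.
have [[ O13 O23 Ow1 Owal] [OA7 OB7]] := curve_bO c1 c2 c3 c4 c5 c4_neq0 (F := F) (tau := tau).
pose v s := w c1 c2 c3 c4 c5 (tau s).
pose al s := 1 - 2 * c1 * tau s + m (P2 s) (P3 s).
have OP2 : O 2 P2 by apply: bO_eq O13; exact: nearW P2E.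
have OP3 : O 3 P3 by apply: bO_eq O23; exact: nearW P3E.
have Ov1 : O 1 (fun s => v s - 1) := Ow1.
have Oval : O 5 (fun s => v s - al s).
  by apply: bO_eq Owal; apply: nearW => s; rewrite /al P2E P3E.
have {}OA7 : O 7 (fun s => tau s ^+ 2 / v s - l (P2 s) (P3 s) - rate6 c4 * tau s ^+ 6).
  by apply: bO_eq OA7; apply: nearW => s; rewrite P2E P3E.
have {}OB7 : O 7 (fun s => - (tau s * P2 s / v s) - P3 s - c5 * rate6 c4 * tau s ^+ 6).
  by apply: bO_eq OB7; apply: nearW => s; rewrite P2E P3E.
have O2 : O 1 P2 by bo.
have O3 : O 1 P3 by bo.
have [OX OY OH OA OB] := decomp_bO c1 c2 c3 c4 c5 tau P2 P3 bO_scale O2 O3 H X Y A B dec top.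
clear O2 O3 Ow1 Owal O13 O23.
have [Hn OH'] := bO_inv1 (oner_neq0 R) OH.
have [vn Ov'] := bO_inv1 (oner_neq0 R) Ov1.
have OH0 : O 0 H by apply: (bO_eq (fun s => (H s - 1) + 1)); [apply: nearW => s; ring|bo].
have OY2 : O 2 Y.
  apply: (bO_eq (fun s => - (P2 s + X s * B s + H s * Y s ^+ 3) - (H s - 1) * Y s)); last by bo.
  by apply: filterS dec => s [_ -> _ _ _]; ring.
clear OY.
pose N11 s := X s ^+ 2 * A s + 2 * (X s * Y s * B s) + Y s ^+ 2 * (H s * Y s ^+ 2).
pose Q s := X s * A s + Y s * B s.
pose RA s := tau s ^+ 2 * ((v s - al s) - N11 s) * (H s)^-1 * (v s)^-1
  + (Q s - 2 * tau s) * Q s * (H s)^-1.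
pose RB s := - (tau s * P2 s) * ((v s - al s) - N11 s) * (H s)^-1 * (v s)^-1
  + Q s * P2 s * (H s)^-1 - (tau s - Q s) * (X s * B s + Y s * (H s * Y s ^+ 2)) * (H s)^-1.
have EA : \forall s \near F, A s = (tau s ^+ 2 / v s - l (P2 s) (P3 s)) + RA s.
  near=> s.
  have hn : H s != 0 by near: s.
  have vn' : v s != 0 by near: s.
  have [e1 e2 e3 e4 e5] : decomp c1 c2 c3 c4 c5 (tau s) (P2 s) (P3 s) (H s) (X s) (Y s) (A s) (B s).
    by near: s.
  have hx : H s * X s = tau s - Q s by rewrite [in RHS]e1 /Q; ring.
  have he : v s - al s - N11 s = v s - H s by rewrite /al e5 /N11; ring.
  rewrite /RA he; have -> : A s = (H s * X s) ^+ 2 / H s - l (P2 s) (P3 s) by rewrite e4; field.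
  by rewrite hx; field; rewrite hn vn'.
have EB : \forall s \near F, B s = (- (tau s * P2 s / v s) - P3 s) + RB s.
  near=> s.
  have hn : H s != 0 by near: s.
  have vn' : v s != 0 by near: s.
  have [e1 e2 e3 e4 e5] : decomp c1 c2 c3 c4 c5 (tau s) (P2 s) (P3 s) (H s) (X s) (Y s) (A s) (B s).
    by near: s.
  have hx : H s * X s = tau s - Q s by rewrite [in RHS]e1 /Q; ring.
  have hy : H s * Y s = - (P2 s + X s * B s + Y s * (H s * Y s ^+ 2)) by rewrite [in RHS]e2; ring.
  have he : v s - al s - N11 s = v s - H s by rewrite /al e5 /N11; ring.
  have eB : B s = (H s * X s) * (H s * Y s) / H s - P3 s by rewrite e3; field.
  by rewrite [LHS]eB hx hy /RB he; field; rewrite hn vn'.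
have gain j : (j <= 5)%N -> O j A /\ O j B -> O j.+1 A /\ O j.+1 B.
  move=> j5 [OAj OBj].
  have OQ : O j.+1 Q by rewrite /Q; bo.
  have ON : O (minn 8 j.+1) N11 by rewrite /N11; bo.
  split.
    apply: bO_eq EA _; apply: (bO_eq (fun s => (tau s ^+ 2 / v s - l (P2 s) (P3 s) - rate6 c4 * tau s ^+ 6)
       + rate6 c4 * tau s ^+ 6 + RA s)).
      by apply: nearW => s; ring.
    by rewrite /RA; bo.
  apply: bO_eq EB _; apply: (bO_eq (fun s => (- (tau s * P2 s / v s) - P3 s - c5 * rate6 c4 * tau s ^+ 6)
       + c5 * rate6 c4 * tau s ^+ 6 + RB s)).
    by apply: nearW => s; ring.
  by rewrite /RB; bo.
have {OA OB} [ OA6 OB6] : O 6 A /\ O 6 B.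
  exact: gain 5 isT (gain 4 isT (gain 3 isT (gain 2 isT (gain 1 isT (conj OA OB))))).
split=> //; split=> //.
  apply: (bO_eq (fun s => (tau s ^+ 2 / v s - l (P2 s) (P3 s) - rate6 c4 * tau s ^+ 6) + RA s)).
    by apply: filterS EA => s ->; ring.
  by rewrite /RA /N11 /Q; bo.
apply: (bO_eq (fun s => (- (tau s * P2 s / v s) - P3 s - c5 * rate6 c4 * tau s ^+ 6) + RB s)).
  by apply: filterS EB => s ->; ring.
by rewrite /RB /N11 /Q; bo.
Unshelve. all: by end_near.
Qed.

(** Testing the normal equations against the step itself gives [full_form] = G2 V2 + G3 V3. In [V2]
    the order 6 terms of h y^3 and c4 a cancel, in [V3] those of b and c5 a. *)
Lemma curve_full_form : exists2 C : R, 0 < C &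
  \forall s \near F, full_form c1 c2 c3 c4 c5 (G2 s) (G3 s) <= (C * tau s ^+ 7) ^+ 2.
Proof.
have [[ OP2 OP3 OY] [OA7 OB7 OX OH]] := curve_AB_bO.
have OA : O 6 A.
  by apply: (bO_eq (fun s => (A s - rate6 c4 * tau s ^+ 6) + rate6 c4 * tau s ^+ 6));
    [apply: nearW => s; ring|bo].
have OB : O 6 B.
  by apply: (bO_eq (fun s => (B s - c5 * rate6 c4 * tau s ^+ 6) + c5 * rate6 c4 * tau s ^+ 6));
    [apply: nearW => s; ring|bo].
have OH0 : O 0 H by apply: (bO_eq (fun s => (H s - 1) + 1)); [apply: nearW => s; ring|bo].
pose k2 : R := (2 * c4)^-1.
have XE : O 2 (fun s => X s - tau s).
  apply: (bO_eq (fun s => - ((H s - 1) * X s + X s * A s + Y s * B s))); last by bo.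
  by apply: filterS dec => s [-> _ _ _ _]; ring.
have P2E' : O 3 (fun s => P2 s - k2 * tau s ^+ 2).
  apply: (bO_eq (fun s => k2 * ((H s - 1) * X s ^+ 2 + (X s - tau s) * (X s + tau s)
      - A s + 2 * c5 * P3 s))); last by bo.
  apply: filterS dec => s [_ _ _ e4 _]; rewrite /k2.
  have -> : P2 s = (H s * X s ^+ 2 - A s + 2 * c5 * P3 s) / (2 * c4) by rewrite -e4; field.
  by field.
have YE : O 3 (fun s => Y s + k2 * tau s ^+ 2).
  apply: (bO_eq (fun s => - (P2 s - k2 * tau s ^+ 2) - X s * B s - H s * Y s ^+ 3
    - (H s - 1) * Y s)); last by bo.
  by apply: filterS dec => s [_ -> _ _ _]; ring.
have Y3E : O 7 (fun s => H s * Y s ^+ 3 + k2 ^+ 3 * tau s ^+ 6).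
  apply: (bO_eq (fun s => (H s - 1) * Y s ^+ 3 + (Y s + k2 * tau s ^+ 2) *
     (Y s ^+ 2 - Y s * (k2 * tau s ^+ 2) + k2 ^+ 2 * tau s ^+ 4))); last by bo.
  by apply: nearW => s; ring.
pose N11 s := X s ^+ 2 * A s + 2 * (X s * Y s * B s) + Y s ^+ 2 * (H s * Y s ^+ 2).
pose N12 s := - (X s * A s + Y s * B s).
pose N13 s := - (X s * B s + Y s * (H s * Y s ^+ 2)).
pose M s := (N11 s + 2 * c1 * N12 s) / W.
pose V2 s := 2 * c2 * M s - 2 * N13 s + 2 * c4 * A s.
pose V3 s := - (2 * c3) * M s - 2 * c5 * A s + 2 * B s.
have OM : O 7 M by rewrite /M /N11 /N12; bo.
have OV2 : O 7 V2.
  apply: (bO_eq (fun s => 2 * c2 * M s + 2 * (X s * B s) + 2 * (H s * Y s ^+ 3 + k2 ^+ 3 * tau s ^+ 6)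
    + 2 * c4 * (A s - rate6 c4 * tau s ^+ 6))); last by bo.
  by apply: nearW => s; rewrite /V2 /N13 /k2 /rate6; field.
have OV3 : O 7 V3.
  apply: (bO_eq (fun s => - (2 * c3) * M s - 2 * c5 * (A s - rate6 c4 * tau s ^+ 6)
    + 2 * (B s - c5 * rate6 c4 * tau s ^+ 6))); last by bo.
  by apply: nearW => s; rewrite /V3; ring.
have [C2 C2_gt0 h2] := bO_pos OV2.
have [C3 C3_gt0 h3] := bO_pos OV3.
exists (C2 + C3); first by rewrite addr_gt0.
near=> s.
have t01 : 0 < tau s < 1 by near: s; exact: scaleP.
have t7 : 0 < tau s ^+ 7 by rewrite exprn_gt0//; case/andP: t01.
have hV2 : `|V2 s| <= C2 * tau s ^+ 7 by near: s.
have hV3 : `|V3 s| <= C3 * tau s ^+ 7 by near: s.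
have n : normal_eqs c1 c2 c3 c4 c5 (H s) (X s) (Y s) (A s) (B s) (G1 s) (G2 s) (G3 s).
  by near: s.
have hQ : full_form c1 c2 c3 c4 c5 (G2 s) (G3 s) = G2 s * V2 s + G3 s * V3 s.
  have /= := normal_eqs_form _ _ _ _ _ _ _ _ _ _ _ _ _ (G2 s) (G3 s) n.
  by rewrite /full_form /tan_form /V2 /V3 /M /N11 /N12 /N13; lra.
set q := Num.sqrt (full_form c1 c2 c3 c4 c5 (G2 s) (G3 s)).
have q0 : 0 <= q by exact: sqrtr_ge0.
have qE : full_form c1 c2 c3 c4 c5 (G2 s) (G3 s) = q ^+ 2 by rewrite sqr_sqrtr// full_form_ge0.
have le_q (u : R) : 2 * u ^+ 2 <= full_form c1 c2 c3 c4 c5 (G2 s) (G3 s) -> `|u| <= q.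
  move=> hu; rewrite -(@ler_pXn2r _ 2) ?nnegrE// real_normK ?num_real// -qE.
  have := sqr_ge0 u; lra.
have [/le_q g2q /le_q g3q] := full_form_ge c1 c2 c3 c4 c5 (G2 s) (G3 s).
have le_mul (u v C : R) : `|u| <= q -> `|v| <= C -> u * v <= q * C.
  by move=> hu hv; rewrite (le_trans (ler_norm _))// normrM ler_pM.
have hq : q <= (C2 + C3) * tau s ^+ 7.
  have [q_le0|q_gt0] := leP q 0.
    by rewrite (le_trans q_le0)// mulr_ge0 ?(ltW t7)// ltW// addr_gt0.
  rewrite -(ler_pM2l q_gt0) -expr2 -qE hQ.
  by have := le_mul _ _ _ g2q hV2; have := le_mul _ _ _ g3q hV3; lra.
by rewrite qE ler_pXn2r ?nnegrE// (le_trans q0).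
Unshelve. all: by end_near.
Qed.
End CurveState.

Lemma curve_in_tube : exists2 K : R, 0 < K & forall e : R, 0 < e -> \forall t \near 0^'+,
  exists s, [/\ tube c1 c2 c3 c4 c5 K s, 0 < height c1 c2 c3 s < e &
    G c1 c2 c3 c4 c5 t = pt c1 c2 c3 c4 c5 (sp1 s) (sp2 s) (sp3 s)].
Proof.
pose D : set (@state R) := [set s | [/\ valid c1 c2 c3 c4 c5 s,
  sp2 s = g13 c1 c2 c3 c4 c5 (sp1 s) & sp3 s = g23 c1 c2 c3 c4 c5 (sp1 s)]].
pose P2 (s : @state R) := g13 c1 c2 c3 c4 c5 (sp1 s).
pose P3 (s : @state R) := g23 c1 c2 c3 c4 c5 (sp1 s).
have dec : \forall s \near to0 D sp1, decomp c1 c2 c3 c4 c5 (sp1 s) (P2 s) (P3 s)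
    (sh s) (sx s) (sy s) (sa s) (sb s).
  by apply: to0_dom => s [[h _ _] e2 e3]; rewrite /P2 /P3 -e2 -e3.
have top : \forall s \near to0 D sp1, top_range (sh s) (sx s) (sy s).
  by apply: to0_dom => s [[_ h _] _ _].
have nor : \forall s \near to0 D sp1,
    normal_eqs c1 c2 c3 c4 c5 (sh s) (sx s) (sy s) (sa s) (sb s) (sg1 s) (sg2 s) (sg3 s).
  by apply: to0_dom => s [[_ _ h] _ _].
have E2 s : P2 s = g13 c1 c2 c3 c4 c5 (sp1 s) by [].
have E3 s : P3 s = g23 c1 c2 c3 c4 c5 (sp1 s) by [].
have [[ OP2 OP3 _] _] := curve_AB_bO P2 P3 _ _ _ _ _ E2 E3 dec top.
have [C C0 hC] := curve_full_form P2 P3 _ _ _ _ _ _ _ _ E2 E3 dec top nor.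
have Om : bO (to0 D sp1) sp1 2 (fun s => c1 * m (P2 s) (P3 s) / W) by bo.
(* The estimate is in powers of t = [sp1], the tube in powers of the height, which is at least t /
   2. *)
exists (C * 2 ^+ 7) => [|e e0]; first by rewrite mulr_gt0// exprn_gt0.
have half : 0 < 1 / 2 :> R by lra.
have OP3' : bO (to0 D sp1) sp1 2 P3 by bo.
have [d d0 hd] : \forall s \near to0 D sp1, tube c1 c2 c3 c4 c5 (C * 2 ^+ 7) s
    /\ 0 < height c1 c2 c3 s < 2 * sp1 s.
  near=> s.
  have /andP[t0 _] : 0 < sp1 s < 1 by near: s; exact: scaleP.
  have [vs e2 e3] : D s by near: s; exact: to0_dom.
  have h2 : `|P2 s| <= 1 / 2 * sp1 s ^+ 1 by near: s; exact: bO_small.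
  have h3 : `|P3 s| <= 1 / 2 * sp1 s ^+ 1 by near: s; exact: bO_small.
  have hm : `|c1 * m (P2 s) (P3 s) / W| <= 1 / 2 * sp1 s ^+ 1 by near: s; exact: bO_small.
  have hQ : full_form c1 c2 c3 c4 c5 (sg2 s) (sg3 s) <= (C * sp1 s ^+ 7) ^+ 2 by near: s.
  have hE : height c1 c2 c3 s = sp1 s - c1 * m (P2 s) (P3 s) / W.
    by rewrite /height /b1_coord e2 e3.
  have [hl hu] : 1 / 2 * sp1 s <= height c1 c2 c3 s /\ height c1 c2 c3 s < 2 * sp1 s.
    by rewrite hE; move: hm; rewrite expr1 ler_norml; lra.
  split; last by rewrite hu andbT; lra.
  split=> //.
  - by rewrite e2 -/(P2 s) (le_trans h2)// expr1.
  - by rewrite e3 -/(P3 s) (le_trans h3)// expr1.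
  - apply: (le_trans hQ); rewrite ler_pXn2r ?nnegrE//; last 2 first.
    + by rewrite mulr_ge0 ?exprn_ge0// ltW.
    + by rewrite !mulr_ge0 ?exprn_ge0// ?(ltW C0)//; lra.
    rewrite -mulrA -exprMn ler_pM2l// ler_pXn2r ?nnegrE//; lra.
have Sr : Scale (0^'+ : set_system R) id.
  split=> [|f f0]; first exact: at_right_proper_filter.
  near=> x; apply/andP; split; first by near: x; exact: nbhs_right_gt.
  by near: x; exact: nbhs_right_lt.
have [[ Og2 Og3 _ _] _] := curve_bO c1 c2 c3 c4 c5 c4_neq0 (F := (0^'+ : set_system R)) (tau := id).
have Og2' : bO (0^'+ : set_system R) id 1 (g13 c1 c2 c3 c4 c5) by bo.
have Og3' : bO (0^'+ : set_system R) id 1 (g23 c1 c2 c3 c4 c5) by bo.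
have de0 : 0 < Num.min d (e / 2) by rewrite lt_min d0 divr_gt0.
near=> t.
have /andP[t0] : 0 < t < Num.min d (e / 2) by near: t; exact: (@scaleP _ _ _ _ Sr).
rewrite lt_min => /andP[td te].
have [s [vs [e1 e2 e3]]] : exists s, valid c1 c2 c3 c4 c5 s /\
    [/\ sp1 s = t, sp2 s = g13 c1 c2 c3 c4 c5 t & sp3 s = g23 c1 c2 c3 c4 c5 t].
  by near: t; exact: (valid_exists c1 c2 c3 c4 c5 id _ _ bO_scale Og2' Og3').
have [||ts /andP[h0 h1]] := hd s; first by rewrite /D /= e1.
  by rewrite e1 t0.
exists s; split=> //; last by rewrite e1 e2 e3.
by rewrite h0 (lt_trans h1)// e1; lra.
Unshelve. all: by end_near.
Qed.
End StartInTube.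

(** * The recurrence *)

Lemma bO_cvg {R : realType} {T : Type} {F : set_system T} {tau : T -> R}
    {S : Scale F tau} (f : T -> R) (a : R) :
  bO F tau 1 (fun s => f s - a) -> f @ F --> a.
Proof.
move=> hf; apply/cvgrPdist_le => e e0.
by apply: filterS (bO_small0 e0 hf) => s; rewrite distrC.
Qed.

Section Recurrence.
Context {R : realType} (q : nat -> R) (kap C : R).
Hypotheses (kap_gt0 : 0 < kap) (q_gt0 : forall k, 0 < q k).
Hypothesis q_dec : forall k, q k.+1 <= q k - kap / 2 * q k ^+ 7.
Hypothesis q_rec : forall k, `|q k.+1 - q k + kap * q k ^+ 7| <= C * q k ^+ 8.

(** A positive limit would make q decrease by a fixed amount at every step. *)
Lemma recurrence_cvg0 : q @ \oo --> 0.
Proof.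
have dec : nonincreasing_seq q.
  apply/nonincreasing_seqP => k; apply: (le_trans (q_dec k)).
  by rewrite gerBl mulr_ge0 ?exprn_ge0 ?divr_ge0// ltW.
have cq : cvgn q.
  apply: nonincreasing_is_cvgn => //.
  by exists 0 => _ [k _ <-]; exact: ltW.
have l0 : 0 <= limn q by apply: limr_ge => //; apply: nearW => k; exact: ltW.
suff : limn q <= 0 by move=> h; rewrite -(@le_anti _ _ (limn q) 0) ?h ?l0.
rewrite leNgt; apply/negP => lpos.
have le7 k : limn q ^+ 7 <= q k ^+ 7.
  by rewrite lerXn2r ?nnegrE// ?(ltW (q_gt0 _))//; exact: nonincreasing_cvgn_ge.
pose d := kap / 2 * limn q ^+ 7.
have d0 : 0 < d by rewrite mulr_gt0 ?exprn_gt0 ?divr_gt0.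
have qk k : q k <= q 0%N - k%:R * d.
  elim: k => [|k IH]; first by rewrite mul0r subr0.
  have : kap / 2 * limn q ^+ 7 <= kap / 2 * q k ^+ 7 by rewrite ler_pM2l// divr_gt0.
  by have := q_dec k; rewrite -natr1 -/d; lra.
have := qk (Num.bound (q 0%N / d)); have := q_gt0 (Num.bound (q 0%N / d)).
have := archi_boundP (divr_ge0 (ltW (q_gt0 0%N)) (ltW d0)).
by rewrite ltr_pdivrMr//; lra.
Qed.

Lemma recurrence_scale : Scale (\oo : set_system nat) q.
Proof.
split=> [|e e0]; first exact: eventually_filter.
move/cvgrPdist_lt: recurrence_cvg0 => /(_ e e0).
by apply: filterS => k; rewrite sub0r normrN gtr0_norm// q_gt0.
Qed.

Lemma recurrence_rate : (fun k : nat => k%:R * q k ^+ 6) @ \oo --> (6 * kap)^-1.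
Proof.
have S := recurrence_scale.
have qn k : q k != 0 by rewrite gt_eqF.
pose u k := (q k ^+ 6)^-1.
pose D k := (q k - q k.+1) / q k ^+ 7 - kap.
pose rho k := q k.+1 / q k.
have OD : bO \oo q 1 D.
  exists C; apply: nearW => k; have q7 : 0 < q k ^+ 7 by rewrite exprn_gt0.
  have -> : D k = - (q k.+1 - q k + kap * q k ^+ 7) / q k ^+ 7.
    by rewrite /D; field; rewrite qn.
  by rewrite normrM normrN normfV (gtr0_norm q7) ler_pdivrMr// expr1 -mulrA -exprS.
have Orho : bO \oo q 1 (fun k => rho k - 1).
  apply: (bO_eq (fun k => - q k ^+ 6 * (D k + kap))); last by bo.
  by apply: nearW => k; rewrite /rho /D; field; rewrite qn.
have [rn Orho'] := bO_inv1 (oner_neq0 R) Orho.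
have Orho0 : bO \oo q 0 rho.
  by apply: (bO_eq (fun s => (rho s - 1) + 1)); [apply: nearW => s; ring|bo].
(* With S = 1 + rho + ... + rho^5, the increment of q^-6 is (D + kap) S / rho^6, and 6 rho^6 - S =
   (rho - 1)(1 + 2 rho + ... + 6 rho^5). *)
have du : bO \oo q 1 (fun k => telescope u k - 6 * kap).
  apply: (bO_eq (fun k => (D k * (1 + rho k + rho k ^+ 2 + rho k ^+ 3 + rho k ^+ 4 + rho k ^+ 5)
    - kap * (rho k - 1) * (1 + 2 * rho k + 3 * rho k ^+ 2 + 4 * rho k ^+ 3 + 5 * rho k ^+ 4
      + 6 * rho k ^+ 5)) * (rho k)^-1 ^+ 6)); last by bo.
  apply: nearW => k; rewrite /telescope /= /u /D /rho; field.
  by rewrite !qn.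
have mean := cesaro (bO_cvg (S := S) _ _ du).
(* The mean of the first k + 1 increments telescopes to (u k.+1 - u 0) / (k + 1), hence the shift of
   index. *)
have u_mean : (fun k : nat => k.+1%:R^-1 * u k.+1) @ \oo --> 6 * kap.
  have -> : (fun k : nat => k.+1%:R^-1 * u k.+1) =
      (fun k => arithmetic_mean (telescope u) k + k.+1%:R^-1 * u 0%N).
    by apply/funext => k; rewrite /arithmetic_mean telescopeK /= mulrBr subrK.
  have h0 : (fun k : nat => k.+1%:R^-1 * u 0%N) @ \oo --> 0.
    rewrite -(mul0r (u 0%N)); apply: cvgM; [exact: cvg_harmonic|exact: cvg_cst].
  by rewrite -[6 * kap]addr0; exact: cvgD mean h0.
rewrite -cvg_shiftS /=.
have -> : (fun k : nat => k.+1%:R * q k.+1 ^+ 6) = (fun k => (k.+1%:R^-1 * u k.+1)^-1).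
  by apply/funext => k; rewrite /u invfM !invrK.
by apply: cvgV => //; rewrite gt_eqF// mulr_gt0.
Qed.
End Recurrence.

(** * Conclusion *)

Section Conclusion.
Context {R : realType}.

(** For y >= 0 the cofactor of 1 - y in 1 - y^6 is at least 1, so |1 - y| <= |1 - y^6|. *)
Lemma cvg_root6 (y : nat -> R) : (forall k, 0 <= y k) ->
  (fun k => y k ^+ 6) @ \oo --> (1 : R) -> y @ \oo --> (1 : R).
Proof.
move=> y0 /cvgrPdist_le h; apply/cvgrPdist_le => e /h; apply: filterS => k.
apply: le_trans; have -> : 1 - y k ^+ 6 = (1 - y k) *
  (1 + y k * (1 + y k + y k ^+ 2 + y k ^+ 3 + y k ^+ 4)) by ring.
rewrite normrM ler_peMr// ger0_norm ?lerDl ?addr_ge0// ?mulr_ge0// ?addr_ge0// ?exprn_ge0//.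
Qed.

Lemma powR16K (a : R) : 0 <= a -> (a `^ (1 / 6)) ^+ 6 = a.
Proof.
by move=> a0; rewrite -powR_mulrn ?powR_ge0// -powRrM div1r mulVf// powRr1.
Qed.

(** Pythagoras along [B1], whose squared norm is 2 (1 + 2 c1^2). *)
Lemma frob_norm_pt (c1 c2 c3 c4 c5 p1 p2 p3 : R) :
  frob_norm (pt c1 c2 c3 c4 c5 p1 p2 p3 - Ustar R) ^+ 2 =
  2 * (1 + 2 * c1 ^+ 2) * b1_coord c1 c2 c3 p1 p2 p3 ^+ 2
  + full_form c1 c2 c3 c4 c5 p2 p3.
Proof.
have W0 : 1 + 2 * c1 ^+ 2 != 0 by rewrite gt_eqF// W_gt0.
rewrite sqr_sqrtr ?frob_dot_ge0// ptE frob_dot_mx3 !mxE /=.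
by rewrite /b1_coord /full_form /tan_form; field.
Qed.

Lemma Theta_of_cvg (u : nat -> R) (c : R) : 0 < c ->
  (fun k : nat => c * (k%:R : R) `^ (1 / 6) * u k) @ \oo --> (1 : R) ->
  Theta u (fun k => (k%:R : R) `^ (- (1 / 6))).
Proof.
move=> c0 /cvgrPdist_le /(_ (1 / 2)) h.
exists (1 / 2 / c), (2 / c); split; rewrite ?divr_gt0//.
near=> k.
have k0 : 0 < (k%:R : R) by rewrite ltr0n; near: k; exact: nbhs_infty_gt.
have p0 : 0 < (k%:R : R) `^ (1 / 6) by rewrite powR_gt0.
have cp0 := mulr_gt0 c0 p0.
have : `|1 - c * (k%:R : R) `^ (1 / 6) * u k| <= 1 / 2 by near: k; apply: h; lra.
rewrite powRN; set p := _ `^ _ in p0 cp0 *; rewrite ler_norml.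
have -> : 1 / 2 / c * p^-1 = (1 / 2) / (c * p) by rewrite invfM mulrA.
have -> : 2 / c * p^-1 = 2 / (c * p) by rewrite invfM mulrA.
move=> /andP[lo hi]; apply/andP; split.
  by rewrite ler_pdivrMr// [u k * _]mulrC; lra.
by rewrite ler_pdivlMr// [u k * _]mulrC; lra.
Unshelve. all: by end_near.
Qed.

End Conclusion.

Theorem theorem7p1 (R : realType) (c1 c2 c3 c4 c5 : R) (hc4 : c4 != 0) :
  \forall t \near (0 : R)^'+,
    Theta (fun k => frob_norm (U c1 c2 c3 c4 c5 t k - Ustar R))
          (fun k => (k%:R : R) `^ (- (1 / 6)))
    /\
    (fun k : nat => (3 / (32 * c4 ^+ 4 * (2 * c1 ^+ 2 + 1) ^+ 4)) `^ (1 / 6)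
       * (k%:R : R) `^ (1 / 6)
       * frob_norm (U c1 c2 c3 c4 c5 t k - Ustar R)) @ \oo --> (1 : R).
Proof.
have [K K_gt0 start] := curve_in_tube c1 c2 c3 c4 c5 hc4.
have [e [C [e_gt0 step]]] := tube_step c1 c2 c3 c4 c5 hc4 K K_gt0.
have W_gt0 := W_gt0 c1; set W := 1 + 2 * c1 ^+ 2 in W_gt0.
have W0 : W != 0 by rewrite gt_eqF.
have c44 : 0 < c4 ^+ 4 by rewrite exprn_even_gt0.
set c0 := 3 / _.
have c0_gt0 : 0 < c0.
  have W1 : 0 < 2 * c1 ^+ 2 + 1 by rewrite addrC.
  by apply: divr_gt0 => //; apply: mulr_gt0; [exact: mulr_gt0|exact: exprn_gt0].
apply: filterS (start e e_gt0) => t [s0 [ts0 hs0 e0]].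
have run k : exists s, [/\ tube c1 c2 c3 c4 c5 K s, 0 < height c1 c2 c3 s < e &
    U c1 c2 c3 c4 c5 t k = pt c1 c2 c3 c4 c5 (sp1 s) (sp2 s) (sp3 s)].
  elim: k => [|k [s [ts hs es]]]; first by exists s0.
  have [ep /andP[n0 nle] _ _ [s' ts' [f1 f2 f3]]] := step s ts hs.
  have hs' : height c1 c2 c3 s' = next_height c1 c2 c3 s.
    by rewrite /height /next_height f1 f2 f3.
  exists s'; split=> //.
    rewrite hs' n0 (le_lt_trans nle)//; case/andP: hs => h0 h1.
    apply: le_lt_trans h1; rewrite gerBl mulr_ge0 ?exprn_ge0 ?(ltW h0)//.
    by rewrite !divr_ge0 ?(ltW W_gt0)// /rate6 invr_ge0 mulr_ge0// ltW.
  by rewrite /U iterS -/(U c1 c2 c3 c4 c5 t k) es ep f1 f2 f3.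
(* Reading the coordinates off the matrix entries makes q a function of k without choosing the
   states provided by [run]. *)
pose q k := b1_coord c1 c2 c3 (U c1 c2 c3 c4 c5 t k 0 1)
  (- U c1 c2 c3 c4 c5 t k 0 2) (U c1 c2 c3 c4 c5 t k 1 2).
have qE s k : U c1 c2 c3 c4 c5 t k = pt c1 c2 c3 c4 c5 (sp1 s) (sp2 s) (sp3 s) ->
    q k = height c1 c2 c3 s.
  by move=> es; rewrite /q es ptE !mxE /= opprK.
have q_next s k : tube c1 c2 c3 c4 c5 K s -> 0 < height c1 c2 c3 s < e ->
    U c1 c2 c3 c4 c5 t k = pt c1 c2 c3 c4 c5 (sp1 s) (sp2 s) (sp3 s) ->
    q k.+1 = next_height c1 c2 c3 s.
  move=> ts hs es; have [ep _ _ _ _] := step s ts hs.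
  rewrite /q /U iterS -/(U c1 c2 c3 c4 c5 t k) es ep.
  by rewrite ptE !mxE /= opprK.
pose kap := rate6 c4 / W.
have kap_gt0 : 0 < kap by rewrite divr_gt0// /rate6 invr_gt0 mulr_gt0.
have q_gt0 k : 0 < q k.
  by have [s [ts hs es]] := run k; rewrite (qE s)//; case/andP: hs.
have q_dec k : q k.+1 <= q k - kap / 2 * q k ^+ 7.
  have [s [ts hs es]] := run k; rewrite (q_next s)// (qE s)//.
  by have [_ /andP[]] := step s ts hs.
have q_rec k : `|q k.+1 - q k + kap * q k ^+ 7| <= C * q k ^+ 8.
  have [s [ts hs es]] := run k; rewrite (q_next s)// (qE s)//.
  by have [] := step s ts hs.
have S := recurrence_scale q kap kap_gt0 q_gt0 q_dec.
have rate := recurrence_rate q kap C kap_gt0 q_gt0 q_dec q_rec.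
pose p2 k := - U c1 c2 c3 c4 c5 t k 0 2; pose p3 k := U c1 c2 c3 c4 c5 t k 1 2.
have Op : bO \oo q 2 p2 /\ bO \oo q 2 p3.
  split; exists C; apply: nearW => k; have [s [ts hs es]] := run k;
  have [_ _ _ [h2 h3] _] := step s ts hs;
  by rewrite (qE s)// ?/p2 ?/p3 es ptE !mxE /= ?opprK.
have [ Op2 Op3] := Op.
pose nu k := frob_norm (U c1 c2 c3 c4 c5 t k - Ustar R).
have nuE k : nu k ^+ 2 = 2 * W * q k ^+ 2 + full_form c1 c2 c3 c4 c5 (p2 k) (p3 k).
  have [s [ts hs es]] := run k.
  rewrite /nu es frob_norm_pt (qE s)// /p2 /p3 es ptE !mxE /= opprK.
  by [].
have ratio : (fun k => nu k ^+ 2 / q k ^+ 2) @ \oo --> 2 * W.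
  have Q4 : bO \oo q 4 (fun k => full_form c1 c2 c3 c4 c5 (p2 k) (p3 k)).
    by rewrite /full_form /tan_form; bo.
  apply: bO_cvg; have [c c_gt0 hc] := bO_pos Q4; exists c.
  apply: filterS2 hc (scaleP 1 ltr01) => k hk /andP[_ q1].
  have q2 : 0 < q k ^+ 2 by rewrite exprn_gt0.
  have -> : nu k ^+ 2 / q k ^+ 2 - 2 * W = full_form c1 c2 c3 c4 c5 (p2 k) (p3 k) / q k ^+ 2.
    by rewrite nuE; field; rewrite gt_eqF.
  rewrite normrM normfV (gtr0_norm q2) ler_pdivrMr// (le_trans hk)//.
  rewrite -mulrA ler_pM2l// -exprD ler_wiXn2l//; exact: ltW.
have main : (fun k : nat => c0 `^ (1 / 6) * (k%:R : R) `^ (1 / 6) * nu k) @ \oo --> (1 : R).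
  apply: cvg_root6 => [k|].
    by rewrite !mulr_ge0 ?powR_ge0// sqrtr_ge0.
  pose r k := nu k ^+ 2 / q k ^+ 2.
  have -> : (fun k : nat => (c0 `^ (1 / 6) * (k%:R : R) `^ (1 / 6) * nu k) ^+ 6) =
     (fun k : nat => c0 * ((k%:R * q k ^+ 6) * (r k * (r k * r k)))).
    apply/funext => k; rewrite 2!exprMn !powR16K ?ler0n ?(ltW c0_gt0)// /r.
    by field; rewrite gt_eqF.
  (* k q^6 tends to W / (6 [rate6]) = 4 c4^4 W / 3 and (nu / q)^6 to (2 W)^3; the product 32 c4^4
     W^4 / 3 is the inverse of [c0]. *)
  have limE : c0 * ((6 * kap)^-1 * (2 * W * (2 * W * (2 * W)))) = 1.
    by rewrite /c0 /kap /rate6 (addrC _ 1) -/W; field; rewrite W0 hc4.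
  suff : (fun k : nat => c0 * ((k%:R * q k ^+ 6) * (r k * (r k * r k)))) @ \oo -->
    c0 * ((6 * kap)^-1 * (2 * W * (2 * W * (2 * W)))) by rewrite limE.
  apply: cvgM; first exact: cvg_cst.
  by apply: cvgM => //; apply: cvgM => //; apply: cvgM.
split; last exact: main.
by apply: Theta_of_cvg main; rewrite powR_gt0.
Qed.
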